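(* For non-negative integers $n,m,k,l$ with $m,k\le n$, $m+k-n\le l\le \min(m,k)$, $m\le n-m$, and $x=0,1,\dots,m$, we have \[ p(x\mid n,m,k,l\mid q)=\begin{bmatrix}n-k\\ m-l\end{bmatrix}_q\frac{\begin{bmatrix}n\\ x\end{bmatrix}_q}{\begin{bmatrix}n\\ m\end{bmatrix}_q}\, q^x\frac{[n-2x+1]_q}{[n-x+1]_q}\;{}_4\phi_3\!\left(\begin{matrix}q^{-x},\ q^{x-n-1},\ q^{-M},\ q^{-N}\\ q^{-m},\ q^{m-n},\ q^{-M-N}\end{matrix};q,q\right), \] where $M:=m-l$, $N:=n-m-k+l$.
   Context: Let $q$ be a prime power, $\mathcal{V}$ an $n$-dimensional $\mathbb{F}_q$-space with basis $v_1,\dots,v_n$, $\mathcal{V}_i:=\mathrm{span}(v_1,\dots,v_i)$, $\mathcal{V}_k^c:=\mathrm{span}(v_{k+1},\dots,v_n)$. Let $G=\mathrm{GL}(\mathcal{V})$, $K=\{g\in G: g\mathcal{V}_m=\mathcal{V}_m\}$; $\mathrm{Ind}_K^G 1=\bigoplus_{x=0}^m\mathcal{V}_x$ multiplicity-free, with $\mathcal{V}_x$ the irreducible character $\chi_x$ corresponding (under the characteristic map) to the Schur function $s_{(n-x,x)}$, and $\dim\mathcal{V}_x=q^x\frac{[n-2x+1]_q}{[n-x+1]_q}\begin{bmatrix}n\\ x\end{bmatrix}_q$. Let $\mathcal{T}=(\mathbb{C}^2)^{\otimes\mathbb{P}^1(\mathcal{V})}$ (tensor factors indexed by lines in $\mathcal{V}$),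 with $G$ acting by $\varphi$ permuting lines; for a subspace $\mathcal{W}$ let $|e_{\mathcal{W}}\rangle$ have factor $|1\rangle$ at lines $L\subset\mathcal{W}$ and $|0\rangle$ elsewhere. Set $|\Xi_{n,m|k,l|q}\rangle:=\begin{bmatrix}n-k\\ m-l\end{bmatrix}_q^{-1/2}\sum_{\mathcal{W}}|e_{\mathcal{W}}\rangle$, summing over $\mathcal{W}$ with $\mathcal{V}_l\subset\mathcal{W}$, $\dim\mathcal{W}=m$, $\dim(\mathcal{W}\cap\mathcal{V}_k^c)=m-l$; $\mathsf{P}_{x|q}:=\frac{\dim\mathcal{V}_x}{|G|}\sum_{g\in G}\chi_x(g)\varphi(g)$; and $p(x\mid n,m,k,l\mid q):=\langle\Xi_{n,m|k,l|q}|\mathsf{P}_{x|q}|\Xi_{n,m|k,l|q}\rangle$. Notation: $(a;q)_r=(1-a)(1-aq)\cdots(1-aq^{r-1})$, $[n]_q=1+q+\dots+q^{n-1}$, $\begin{bmatrix}n\\ m\end{bmatrix}_q=\frac{(q;q)_n}{(q;q)_m(q;q)_{n-m}}$, and ${}_4\phi_3\!\left(\begin{matrix}a_1,\dots,a_4\\ b_1,b_2,b_3\end{matrix};q,z\right)=\sum_{r\ge0}\frac{(a_1,\dots,a_4;q)_r}{(b_1,b_2,b_3,q;q)_r}z^r$. *)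

(* Defs.v *)
From HB Require Import structures.
From mathcomp Require Import all_boot all_order all_algebra all_field.
Set Implicit Arguments. Unset Strict Implicit. Unset Printing Implicit Defensive.
Import Order.TTheory GRing.Theory Num.Theory.
Local Open Scope ring_scope.

Section QNotation.
Variable q : algC.

Definition qpoch (a : algC) (r : nat) : algC := \prod_(i < r) (1 - a * q ^+ i).
Definition qint (n : nat) : algC := \sum_(i < n) q ^+ i.
Definition qbinom (n m : nat) : algC := qpoch q n / (qpoch q m * qpoch q (n - m)).
Definition phi43 (a1 a2 a3 a4 b1 b2 b3 z : algC) (bound : nat) : algC :=
  \sum_(r < bound.+1)
    (qpoch a1 r * qpoch a2 r * qpoch a3 r * qpoch a4 r)
    / (qpoch b1 r * qpoch b2 r * qpoch b3 r * qpoch q r) * z ^+ r.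
End QNotation.

Section Geometry.
Variables (F : finFieldType) (n : nat).

Definition spanset r (A : 'M[F]_(r, n)) : {set 'rV[F]_n} :=
  [set v : 'rV[F]_n | (v <= A)%MS].

Definition subspaces_of_dim (d : nat) : {set {set 'rV[F]_n}} :=
  [set spanset A | A : 'M[F]_n & \rank A == d].

Definition line_type := {L : {set 'rV[F]_n} | L \in subspaces_of_dim 1}.

Definition GLset : {set 'M[F]_n} := [set g : 'M[F]_n | g \in unitmx].

Definition img (g : 'M[F]_n) (W : {set 'rV[F]_n}) : {set 'rV[F]_n} :=
  (fun v => v *m g) @: W.

Definition act_line (g : 'M[F]_n) (L : line_type) : line_type :=
  insubd L (img g (val L)).

(* action on basis states of T = (C^2)^{tensor P^1(V)}: a basis state is
   the set of lines carrying |1> *)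
Definition act_conf (g : 'M[F]_n) (S : {set line_type}) : {set line_type} :=
  act_line g @: S.

(* vectors of T, in coordinates w.r.t. the computational basis *)
Notation Tvec := ({ffun {set line_type} -> algC}) (only parsing).

(* phi(g) |S> = |g S>, extended linearly *)
Definition phiT (g : 'M[F]_n) (f : Tvec) : Tvec :=
  [ffun S' => \sum_(S : {set line_type} | act_conf g S == S') f S].

Definition dotT (u v : Tvec) : algC := \sum_(S : {set line_type}) (u S)^* * v S.

Definition eW (W : {set 'rV[F]_n}) : Tvec :=
  [ffun S => ((S == [set L : line_type | val L \subset W]) : nat)%:R].

Definition perm_char (j : nat) (g : 'M[F]_n) : algC :=
  #|[set W in subspaces_of_dim j | img g W == W]|%:R.

(* chi_x: the character corresponding to s_(n-x,x); via Jacobi-Trudi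
   s_(n-x,x) = h_(n-x) h_x - h_(n-x+1) h_(x-1), and h_(n-j) h_j corresponds
   to the permutation character of G on j-dimensional subspaces *)
Definition chi (x : nat) (g : 'M[F]_n) : algC :=
  perm_char x g - (if x is x'.+1 then perm_char x' g else 0).

Definition dimV (x : nat) : algC := chi x 1%:M.

Definition Pproj (x : nat) (f : Tvec) : Tvec :=
  [ffun S => (dimV x / #|GLset|%:R) * \sum_(g in GLset) chi x g * phiT g f S].

(* Basis v_1..v_n of V = rows of an invertible matrix Bs.
   V_i = span(v_1..v_i) = rowspace (pid_mx i *m Bs),
   V_k^c = span(v_(k+1)..v_n) = rowspace (copid_mx k *m Bs). *)
Definition Xi_set (Bs : 'M[F]_n) (m k l : nat) : {set {set 'rV[F]_n}} :=
  [set spanset A | A : 'M[F]_n &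
     [&& ((pid_mx l : 'M[F]_n) *m Bs <= A)%MS, \rank A == m
       & \rank (A :&: (copid_mx k : 'M[F]_n) *m Bs)%MS == (m - l)%N]].

Definition Xi (Bs : 'M[F]_n) (m k l : nat) : Tvec :=
  [ffun S => (sqrtC (qbinom (#|F|%:R) (n - k) (m - l)))^-1
                * \sum_(W in Xi_set Bs m k l) eW W S].

Definition pGL (Bs : 'M[F]_n) (m k l x : nat) : algC :=
  dotT (Xi Bs m k l) (Pproj x (Xi Bs m k l)).

End Geometry.

(* Main.v *)
Require Import Defs.
From HB Require Import structures.
From mathcomp Require Import all_boot all_order all_algebra all_field.
From mathcomp Require Import ring zify.
Set Implicit Arguments. Unset Strict Implicit. Unset Printing Implicit Defensive.
Import Order.TTheory GRing.Theory Num.Theory.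
Local Open Scope ring_scope.

(** After averaging over GL, everything reduces to the kernel
    H(W,V) = sum_(g : g W = V) chi_x(g) on m-spaces. Summing over the transvections
    1 + f u (with f(u) = 0) is a central operation: it multiplies chi_x by a scalar, as the
    double count of pairs (hyperplane, subspace) shows, while on m-spaces it acts as an affine
    function of the adjacency operator of the Grassmann graph. So H(W,-) is an eigenvector of
    that operator. By transitivity of GL on pairs of subspaces, H(W,V) depends only on
    i = m - dim(W cap V), so the eigenvector equation is a three-term recurrence in i, which
    determines H from its diagonal value; the recurrence is solved by the q-Hahn polynomial
    3phi2(q^-x, q^(x-n-1), q^-i; q^-m, q^(m-n); q, q), and the diagonal value is the number of
    orbits of the stabilizer of W on x-spaces minus that on (x-1)-spaces, times its order.
    Finally, the subspaces in Xi are V_l + U with U an M-space of V_k^c, and the sum of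
    (q^-i; q)_r over such U is evaluated by the stationarity of the same graph walk, now in
    V_k^c; this turns the 3phi2 into the 4phi3. *)

(** * The walk on the Grassmannian and q-Hahn polynomials *)

Section QCalculus.
Variable q : algC.
Hypothesis q_gt1 : 1 < q.

Lemma q_neq0 : q != 0. Proof. by rewrite gt_eqF // (lt_trans ltr01). Qed.

Lemma onesubq_neq0 : 1 - q != 0.
Proof. by rewrite subr_eq0 lt_eqF. Qed.

Lemma expq_neq0 d : q ^+ d != 0. Proof. by rewrite expf_neq0 ?q_neq0. Qed.

Lemma expq_inj d e : (q ^+ d == q ^+ e) = (d == e).
Proof. by rewrite !eq_le !ler_eXn2l ?eqn_leq. Qed.

Lemma qintE d : qint q d = (1 - q ^+ d) / (1 - q).
Proof.
apply: (mulIf onesubq_neq0); rewrite mulfVK ?onesubq_neq0 // /qint.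
elim: d => [|d IHd]; first by rewrite big_ord0 expr0 subrr mul0r.
by rewrite big_ord_recr /= mulrDl IHd exprS; ring.
Qed.

Lemma qint_neq0 d : (0 < d)%N -> qint q d != 0.
Proof.
move=> d_gt0; rewrite qintE mulf_neq0 ?invr_eq0 ?onesubq_neq0 // subr_eq0.
by rewrite -(expr0 q) expq_inj eq_sym -lt0n.
Qed.

Lemma qint_inj d e : qint q d = qint q e -> d = e.
Proof.
rewrite !qintE => /(mulIf (invr_neq0 onesubq_neq0)) /subrI /eqP.
by rewrite expq_inj => /eqP.
Qed.

Lemma qpochS a r : qpoch q a r.+1 = qpoch q a r * (1 - a * q ^+ r).
Proof. by rewrite /qpoch big_ord_recr. Qed.

Lemma qpochSl a r : qpoch q a r.+1 = (1 - a) * qpoch q (a * q) r.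
Proof.
rewrite /qpoch big_ord_recl expr0 mulr1; congr (_ * _).
by apply: eq_bigr => i _; rewrite /= /bump add1n exprS mulrA.
Qed.

(** Only the factor of index [d] can vanish. This truncates the basic hypergeometric sums and,
    within range, keeps their denominators nonzero. *)
Lemma qpoch_eq0 d r : (qpoch q (q ^- d) r == 0) = (d < r)%N.
Proof.
elim: r => [|r IHr]; first by rewrite /qpoch big_ord0 oner_eq0.
rewrite qpochS mulf_eq0 IHr ltnS [RHS]leq_eqVlt orbC; congr (_ || _).
rewrite subr_eq0 -(inj_eq (mulfI (expq_neq0 d))) mulr1 mulrA mulfV ?expq_neq0 //.
by rewrite mul1r expq_inj.
Qed.

Lemma qpoch_qq_neq0 d : qpoch q q d != 0.
Proof.
rewrite /qpoch prodf_seq_neq0; apply/allP => i _ /=.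
by rewrite -exprS subr_eq0 -(expr0 q) expq_inj.
Qed.

Lemma qbinomS n d : (d < n)%N ->
  qbinom q n d.+1 * qint q d.+1 = qbinom q n d * qint q (n - d).
Proof.
move=> lt_dn; rewrite /qbinom !qintE.
have -> : (n - d = (n - d.+1).+1)%N by rewrite subnSK.
rewrite !qpochS -!exprS.
have h' k : (1 - q ^+ k.+1) != 0 by rewrite subr_eq0 -(expr0 q) expq_inj.
have := (onesubq_neq0, qpoch_qq_neq0 d, qpoch_qq_neq0 (n - d.+1), h' d, h' (n - d.+1)%N).
set a := 1 - q; set b := qpoch q q d; set c := qpoch q q (n - d.+1); set e := 1 - _; set f := 1 - _.
by move=> [[[[? ?] ?] ?] ?]; field; do ?[apply/andP; split].
Qed.

Lemma qbinom0 n : qbinom q n 0 = 1.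
Proof. by rewrite /qbinom subn0 {2}/qpoch big_ord0 mul1r divff ?qpoch_qq_neq0. Qed.

Lemma qbinom_neq0 n d : qbinom q n d != 0.
Proof. by rewrite mulf_neq0 ?invr_eq0 ?mulf_neq0 ?qpoch_qq_neq0. Qed.

(** The left side is the number of [x]-spaces minus the number of [(x-1)]-spaces, that is, the
    degree of chi_x; the right side is its product form in the theorem. *)
Lemma qbinom_diff n x : (0 < x)%N -> (2 * x <= n)%N ->
  qbinom q n x - qbinom q n x.-1 =
  qbinom q n x * (q ^+ x * qint q (n - 2 * x + 1) / qint q (n - x + 1)).
Proof.
case: x => // x _ le_xn; have lt_xn : (x < n)%N by lia.
have nx : (n - x.+1 + 1 = n - x)%N by lia.
have h0 : qint q (n - x) != 0 by rewrite qint_neq0 // subn_gt0.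
have -> : qbinom q n x.+1.-1 = qbinom q n x.+1 * qint q x.+1 / qint q (n - x).
  by rewrite qbinomS //= mulfK.
rewrite nx -[X in X - _](mulfK h0) -mulrA -[X in _ - X]mulrA -mulrBr; congr (_ * _).
rewrite -mulrBl; congr (_ / _); rewrite !qintE -mulrBl mulrA; congr (_ / _).
rewrite mulrBr mulr1 -exprD; have -> : (x.+1 + (n - 2 * x.+1 + 1) = n - x)%N by lia.
ring.
Qed.

(* Up to the factor [M][N+1], this is the generator of the walk on the Grassmannian
   of M-spaces in dimension M+N, in the coordinate i = codimension of the meet. *)
Definition walk M N (h : nat -> algC) i :=
  qint q i ^+ 2 * (h i.-1 - h i)
  + (qint q M - qint q i) * (qint q N.+1 - qint q i.+1) * (h i.+1 - h i).

(** On the functions (q^-i; q)_r the walk is bidiagonal, with diagonal entry [- walk_eig] and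
    lowering entry [walk_low]. Quotients of powers replace truncated subtraction; for r <= M + N,
    [walk_eig] is [r][M+N-r+1]. *)
Definition walk_eig M N r := qint q r * ((1 - q * (q ^+ M * q ^+ N / q ^+ r)) / (1 - q)).
Definition walk_low M N r :=
  - (1 - q ^+ r.+1) * (q ^+ r - q ^+ M) * (q ^+ r - q ^+ N) / (q ^+ r * (1 - q) ^+ 2).

Lemma walk_qpoch0 M N i : walk M N (fun i => qpoch q (q ^- i) 0) i = 0.
Proof. by rewrite /walk /qpoch !big_ord0 subrr !mulr0 addr0. Qed.

(** The values at [i], [i.+1] and [i.-1] share almost all their factors, so after both shifts are
    written through (q^-i; q)_r a rational identity in the powers of [q] remains. *)
Lemma walk_qpochS M N r i :
  walk M N (fun i => qpoch q (q ^- i) r.+1) i =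
  - walk_eig M N r.+1 * qpoch q (q ^- i) r.+1 + walk_low M N r * qpoch q (q ^- i) r.
Proof.
have hi := expq_neq0 i; have hr := expq_neq0 r; have q0 := q_neq0; have q1 := onesubq_neq0.
have e_next : qpoch q (q ^- i.+1) r.+1 = (1 - q ^- i / q) * qpoch q (q ^- i) r.
  rewrite qpochSl exprS invfM; congr (_ * qpoch _ _ _); first by rewrite mulrC.
  by rewrite mulrAC mulVf // mul1r.
(* One factor [i] of the down rate supplies the missing factor 1 - q^-i. At i = 0, where [i.-1] is 0
   again, both sides vanish. *)
have e_prev : qint q i * qpoch q (q ^- i.-1) r.+1 =
  - (q ^+ i / (1 - q)) * qpoch q (q ^- i) r * (1 - q ^- i * q ^+ r) * (1 - q ^- i * q ^+ r.+1).
  case: i hi e_next => [|i] hi _ /=.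
    have -> : qint q 0 = 0 by rewrite /qint big_ord0.
    case: r hr => [|r] hr; first by rewrite !expr0 invr1 !mul1r subrr !(mul0r, mulr0).
    by rewrite [qpoch q (q ^- 0) r.+1]qpochSl expr0 invr1 subrr !(mul0r, mulr0).
  rewrite -[RHS]mulrA -[RHS]mulrA.
  rewrite [X in _ * X = _](_ : _ = qpoch q (q ^- i.+1 * q) r.+1); last first.
    by rewrite exprS invfM mulrAC mulVf // mul1r.
  have -> : qpoch q (q ^- i.+1) r * ((1 - q ^- i.+1 * q ^+ r) * (1 - q ^- i.+1 * q ^+ r.+1)) =
     (1 - q ^- i.+1) * qpoch q (q ^- i.+1 * q) r.+1.
    by rewrite mulrA -!qpochS -qpochSl.
  by rewrite mulrA; congr (_ * _); rewrite qintE; field; rewrite q1 hi.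
rewrite /walk expr2 mulrBr -[X in X - _ + _]mulrA e_prev e_next !qpochS /walk_eig /walk_low !qintE.
rewrite !exprS; move: (qpoch _ _ _) => E.
move: (q ^+ i) (q ^+ r) (q ^+ M) (q ^+ N) hi hr => z y a b hz hy.
by field; rewrite q0 q1 hz hy.
Qed.

Lemma walkZD M N (a : nat -> algC) (h : nat -> nat -> algC) k i :
  walk M N (fun i => \sum_(r < k) a r * h r i) i = \sum_(r < k) a r * walk M N (h r) i.
Proof.
rewrite /walk -!sumrB !big_distrr /= -big_split /=.
by apply: eq_bigr => r _; ring.
Qed.

Definition hahn_coef n m x r :=
  (qpoch q (q ^- x) r * qpoch q (q ^+ x / q ^+ n.+1) r)
  / (qpoch q (q ^- m) r * qpoch q (q ^+ m / q ^+ n) r * qpoch q q r) * q ^+ r.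
Definition hahn n m x i := \sum_(r < x.+1) hahn_coef n m x r * qpoch q (q ^- i) r.

Lemma qpoch_div_neq0 n m r : (r <= n - m)%N -> (m <= n)%N -> qpoch q (q ^+ m / q ^+ n) r != 0.
Proof.
move=> le_r le_mn; have -> : q ^+ m / q ^+ n = q ^- (n - m).
  rewrite -{1}(subnK le_mn) exprD invfM mulrCA mulfV ?expq_neq0 ?mulr1 //.
by rewrite qpoch_eq0 -leqNgt.
Qed.

(** This is the eigenvalue equation read off at (q^-i; q)_r. The difference of [walk_eig] at r and x
    vanishes for q^r equal to q^x or q^(n+1-x), which gives the upper parameters; the zeros q^m and
    q^(n-m) of [walk_low] give the lower ones. *)
Lemma hahn_coefS n m x r : (m <= n - m)%N -> (m <= n)%N -> (r < m)%N ->
  hahn_coef n m x r.+1 * walk_low m (n - m) r =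
  (walk_eig m (n - m) r - walk_eig m (n - m) x) * hahn_coef n m x r.
Proof.
move=> le_m le_mn lt_rm.
have e_n : q ^+ n = q ^+ m * q ^+ (n - m) by rewrite -exprD subnKC.
have p1 : qpoch q (q ^- m) r.+1 != 0 by rewrite qpoch_eq0 -leqNgt.
have p2 : qpoch q (q ^+ m / q ^+ n) r.+1 != 0 by apply: qpoch_div_neq0; lia.
have p3 := qpoch_qq_neq0 r.+1.
move: p1 p2 p3; rewrite /hahn_coef /walk_eig /walk_low !qpochS !qintE !mulf_eq0 !negb_or !exprS e_n.
have := (expq_neq0 m, expq_neq0 (n - m), expq_neq0 r, expq_neq0 x, q_neq0, onesubq_neq0).
move: (qpoch _ _ _) (qpoch _ _ _) (qpoch _ _ _) (qpoch _ _ _) (qpoch _ _ _) => A B C D E.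
move: (q ^+ m) (q ^+ (n - m)) (q ^+ r) (q ^+ x) => a b y z [[[[[a0 b0] y0] z0] q0] q1].
move=> /andP[hA hA'] /andP[hB hB'] /andP[hC hC'].
have h1 : a - y != 0.
  by apply: contra hA'; rewrite subr_eq0 => /eqP <-; rewrite mulVf ?subrr.
have h2 : b - y != 0.
  apply: contra hB'; rewrite subr_eq0 => /eqP <-.
  by rewrite invfM mulrA mulfV // mul1r mulVf ?subrr.
by field; do ?[apply/andP; split].
Qed.

Lemma walk_eigE M N r : (r <= M + N)%N -> walk_eig M N r = qint q r * qint q (M + N - r).+1.
Proof.
move=> le_r; rewrite /walk_eig [X in _ = _ * X]qintE; congr (_ * ((1 - _) / _)).
by rewrite exprS -exprD; congr (_ * _); rewrite -{1}(subnK le_r) exprD mulfK ?expq_neq0.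
Qed.

Lemma hahn_walk n m x i : (m <= n - m)%N -> (m <= n)%N -> (x <= m)%N ->
  walk m (n - m) (hahn n m x) i = - walk_eig m (n - m) x * hahn n m x i.
Proof.
move=> le_m le_mn le_xm.
have -> := walkZD m (n - m) (hahn_coef n m x) (fun r i => qpoch q (q ^- i) r) x.+1 i.
rewrite big_ord_recl walk_qpoch0 mulr0 add0r.
under eq_bigr => r _.
  have lt_rm : (r < m)%N by apply: leq_trans le_xm.
  rewrite lift0 walk_qpochS mulrDr [X in _ + X]mulrA hahn_coefS //.
  rewrite [X in _ + X](_ : _ = walk_eig m (n - m) r * (hahn_coef n m x r * qpoch q (q ^- i) r)
    - walk_eig m (n - m) x * (hahn_coef n m x r * qpoch q (q ^- i) r)); last by ring.
  rewrite [X in X + _](_ : _ = - (walk_eig m (n - m) r.+1 * (hahn_coef n m x r.+1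
    * qpoch q (q ^- i) r.+1))); last by ring.
  over.
rewrite /hahn mulNr mulr_sumr.
set u := fun r => walk_eig m (n - m) r * (hahn_coef n m x r * qpoch q (q ^- i) r).
set v := fun r => walk_eig m (n - m) x * (hahn_coef n m x r * qpoch q (q ^- i) r).
(* The sum of [u] telescopes from [u 0 = 0], and the leftover [u x] equals [v x], the term that
   completes the sum of [v]. *)
have -> : \sum_(r < x) (- u r.+1 + (u r - v r)) = - u x - \sum_(r < x) v r.
  have u0 : u 0 = 0 by rewrite /u /walk_eig /qint big_ord0 !mul0r.
  elim: (x) => [|k IHk]; first by rewrite !big_ord0 u0 subr0 oppr0.
  by rewrite !big_ord_recr /= IHk; ring.
by rewrite -opprD big_ord_recr /= addrC.
Qed.

Lemma qpoch1S r : qpoch q (q ^- 0) r.+1 = 0.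
Proof. by apply/eqP; rewrite qpoch_eq0. Qed.

Lemma hahn0 n m x : hahn n m x 0 = 1.
Proof.
rewrite /hahn big_ord_recl big1 => [|i _]; last by rewrite qpoch1S mulr0.
by rewrite /hahn_coef /qpoch /= !big_ord0 expr0 !mulr1 divr1 addr0.
Qed.

(** For i < M <= N the up rate is nonzero, so the equation at [i] determines the value at [i.+1]
    from those at [i] and [i.-1]. At i = 0 the down rate [0] vanishes, so one initial value
    suffices. *)
Lemma walk_unique M N c (f g : nat -> algC) : (M <= N)%N ->
  (forall i, (i < M)%N -> walk M N f i = c * f i) ->
  (forall i, (i < M)%N -> walk M N g i = c * g i) ->
  f 0 = g 0 -> forall i, (i <= M)%N -> f i = g i.
Proof.
move=> le_MN wf wg fg0 i.
suff: (i <= M)%N -> f i = g i /\ f i.-1 = g i.-1 by move=> h /h[].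
elim: i => [|i IHi] lt_iM //; have [fgi fgp] := IHi (ltnW lt_iM); split=> //=.
have := wf i lt_iM; rewrite fgi -wg // /walk fgi fgp => /addrI /mulfI h.
apply/(@addIr _ (- g i))/h; rewrite mulf_neq0 // subr_eq0.
  by apply: contraL lt_iM => /eqP/qint_inj ->; rewrite ltnn.
apply/eqP => /qint_inj; lia.
Qed.

End QCalculus.

(** * Counting subspaces *)

Section Grassmannian.
Variables (F : finFieldType) (n : nat).
Local Notation q := (#|F|%:R : algC).
Implicit Types (A B H I U V W Y Z : 'M[F]_n) (d : nat).

Lemma cardF_gt1 : 1 < q.
Proof. by rewrite ltr1n finNzRing_gt1. Qed.

(* Subspaces are encoded by the matrices A fixed by the normalization <<A>>. *)
Definition grass Y d : {set 'M[F]_n} :=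
  [set A | [&& <<A>>%MS == A, (A <= Y)%MS & \rank A == d]].

Lemma grassP Y d A :
  reflect [/\ <<A>>%MS = A, (A <= Y)%MS & \rank A = d] (A \in grass Y d).
Proof.
rewrite inE; apply: (iffP and3P) => [[/eqP ? ? /eqP ?] //|[-> -> ->]].
by rewrite !eqxx.
Qed.

Lemma grass_genmx Y d m (A : 'M_(m, n)) :
  (<<A>>%MS \in grass Y d) = (A <= Y)%MS && (\rank A == d).
Proof. by rewrite inE genmx_id eqxx !genmxE. Qed.

Lemma genmx_sub_eq A B : <<A>>%MS = A -> <<B>>%MS = B ->
  (A <= B)%MS -> (\rank B <= \rank A)%N -> A = B.
Proof.
move=> gA gB sAB le_r; rewrite -gA -gB; apply/genmxP.
by rewrite -(geq_leqif (mxrank_leqif_eq sAB)).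
Qed.

Lemma grass_sub_eq Y Y' d A B :
  A \in grass Y d -> B \in grass Y' d -> (A <= B)%MS -> A = B.
Proof.
by move=> /grassP[gA _ rA] /grassP[gB _ rB] sAB; apply: genmx_sub_eq; rewrite ?rA ?rB.
Qed.

Lemma card_rowspace m (A : 'M[F]_(m, n)) :
  #|[set v : 'rV[F]_n | (v <= A)%MS]| = (#|F| ^ \rank A)%N.
Proof.
rewrite -[\rank A]mul1n -card_mx -cardsT.
rewrite -(card_imset _ (row_free_inj (row_base_free A))).
apply: eq_card => v; rewrite inE -(eq_row_base A).
by apply/submxP/imsetP => [[u ->]|[u _ ->]]; exists u.
Qed.

Lemma card_rowspaceD m1 m2 (A : 'M[F]_(m1, n)) (B : 'M[F]_(m2, n)) : (A <= B)%MS ->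
  #|[set v : 'rV[F]_n | (v <= B)%MS && ~~ (v <= A)%MS]|%:R =
  q ^+ \rank B - q ^+ \rank A :> algC.
Proof.
move=> sAB; rewrite -!natrX -!card_rowspace.
rewrite -(cardsID [set v : 'rV[F]_n | (v <= A)%MS] [set v : 'rV[F]_n | (v <= B)%MS]).
rewrite natrD (_ : _ :&: _ = [set v : 'rV[F]_n | (v <= A)%MS]); last first.
  apply/setP => v; rewrite !inE andbC; case vA: (v <= A)%MS => //=.
  exact: submx_trans sAB.
rewrite addrC addKr; congr (_%:R); apply: eq_card => v; by rewrite !inE andbC.
Qed.

Lemma mxrank_adds_row A (v : 'rV[F]_n) : ~~ (v <= A)%MS -> \rank (A + v) = (\rank A).+1.
Proof.
move=> vA; apply/eqP; rewrite eqn_leq; apply/andP; split.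
  apply: leq_trans (mxrank_adds_leqif _ _) _.
  by rewrite -[(\rank A).+1]addn1 leq_add2l rank_leq_row.
rewrite ltn_neqAle mxrankS ?addsmxSl // andbT.
apply: contra vA => /eqP rA; have := mxrank_leqif_eq (addsmxSl A v).
rewrite rA => -[_]; rewrite eqxx => /esym/andP[_]; apply: submx_trans.
exact: addsmxSr.
Qed.

Lemma qX_sub_qint d e : (e <= d)%N -> q ^+ d - q ^+ e = q ^+ e * (q - 1) * qint q (d - e).
Proof.
move=> le_ed; rewrite (qintE cardF_gt1) -{1}(subnK le_ed) exprD.
have := onesubq_neq0 cardF_gt1; move: (_%:R) (_ ^+ (d - e)) (_ ^+ e) => c a b h.
by field.
Qed.

(** The vectors of Y outside Z are grouped by the space U = Z + v that they generate; the class of U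
    is U minus Z, so all classes have the same size. *)
Lemma card_above Y Z : (Z <= Y)%MS ->
  #|[set U in grass Y (\rank Z).+1 | (Z <= U)%MS]|%:R = qint q (\rank Y - \rank Z).
Proof.
move=> sZY; have le_d : (\rank Z <= \rank Y)%N by rewrite mxrankS.
have q_gt1 := cardF_gt1.
apply: (@mulfI _ (q ^+ \rank Z * (q - 1))).
  by rewrite mulf_neq0 ?(expq_neq0 q_gt1) // subr_eq0 gt_eqF.
rewrite -qX_sub_qint // -card_rowspaceD // -sum1_card.
set S := [set U in _ | _].
rewrite -[in RHS]sum1_card.
rewrite (partition_big (fun v : 'rV_n => <<(Z + v)%MS>>%MS) (mem S)) /=; last first.
  move=> v; rewrite inE => /andP[vY vZ]; rewrite inE grass_genmx mxrank_adds_row //.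
  by rewrite eqxx addsmx_sub sZY vY genmxE addsmxSl.
rewrite !natr_sum mulr_sumr; apply: eq_bigr => U.
rewrite inE => /andP[/grassP[gU UY rU] ZU]; rewrite mulr1 sum1_card.
rewrite -[LHS]mulr1 [X in _ * X](_ : 1 = qint q (\rank U - \rank Z)); last first.
  by rewrite rU subSnn /qint big_ord1 expr0.
rewrite -qX_sub_qint ?rU // -rU -card_rowspaceD //; congr (_%:R).
apply: eq_card => v; rewrite !inE; apply/idP/idP.
  case/andP=> vU vZ; rewrite unfold_in inE vZ (submx_trans vU UY) /=; apply/eqP.
  apply: genmx_sub_eq; rewrite ?genmx_id // genmxE ?addsmx_sub ?ZU //.
  by rewrite mxrank_adds_row // rU.
by rewrite unfold_in inE => /andP[/andP[_ ->] /eqP <-]; rewrite genmxE addsmxSr.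
Qed.

Definition perp A := <<kermx A^T>>%MS.

Lemma rank_perp A : \rank (perp A) = (n - \rank A)%N.
Proof. by rewrite genmxE mxrank_ker mxrank_tr. Qed.

Lemma perpS A B : (A <= B)%MS -> (perp B <= perp A)%MS.
Proof.
case/submxP=> D ->; rewrite !genmxE sub_kermx trmx_mul mulmxA.
have /sub_kermxP -> := submx_refl (kermx B^T); by rewrite mul0mx.
Qed.

Lemma perpK A : <<A>>%MS = A -> perp (perp A) = A.
Proof.
move=> gA; apply/esym/genmx_sub_eq; rewrite ?genmx_id //.
  rewrite genmxE sub_kermx -[_ *m _]trmxK trmx_mul trmxK.
  have : (perp A <= kermx A^T)%MS by rewrite genmxE.
  by move/sub_kermxP->; rewrite trmx0.
by rewrite !rank_perp subKn // rank_leq_col.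
Qed.

(** Orthogonality turns the hyperplanes of W above I into the spaces of [perp I] one dimension above
    [perp W], which [card_above] counts. *)
Lemma card_below W I d : <<W>>%MS = W -> <<I>>%MS = I -> (I <= W)%MS -> \rank W = d.+1 ->
  #|[set H in grass W d | (I <= H)%MS]|%:R = qint q (\rank W - \rank I).
Proof.
move=> gW gI sIW rW; have le_dn : (d < n)%N by rewrite -rW rank_leq_col.
have perp_sub A B : <<A>>%MS = A -> <<B>>%MS = B -> (perp A <= perp B)%MS = (B <= A)%MS.
  by move=> gA gB; apply/idP/idP => /perpS //; rewrite !perpK.
have gp A : <<perp A>>%MS = perp A by rewrite genmx_id.
have -> : (\rank W - \rank I = \rank (perp I) - (n - d.+1))%N.
  rewrite rank_perp rW; have := rank_leq_col I; have := mxrankS sIW; lia.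
rewrite -rW -[in X in _ = qint _ X]rank_perp -card_above ?perpS ?rank_perp ?rW //; congr (_%:R).
rewrite -(card_in_imset (f := perp)); last first.
  move=> A B; rewrite !inE => /andP[/and3P[/eqP gA _ _] _] /andP[/and3P[/eqP gB _ _] _] e.
  by rewrite -(perpK gA) -(perpK gB) e.
apply: eq_card => K; apply/imsetP/idP.
  case=> H; rewrite inE => /andP[/grassP[gH HW rH] IH] ->.
  by rewrite inE perp_sub // HW andbT inE gp eqxx perp_sub // IH rank_perp rH /= subnSK.
rewrite inE => /andP[/grassP[gK KI rK] WK]; exists (perp K); last by rewrite perpK.
rewrite inE -(perpK gI) perp_sub // KI andbT inE gp eqxx /= -(perpK gW) perp_sub // WK /=.
by rewrite rank_perp rK subnSK // subKn // ltnW.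
Qed.

End Grassmannian.

Lemma sum_const_natl (T : finType) (P : pred T) (c : algC) :
  \sum_(i | P i) c = #|[set i | P i]|%:R * c.
Proof. by rewrite cardsE sumr_const mulr_natl. Qed.

Lemma card_setIN (T : finType) (A : {set T}) (P : pred T) :
  #|[set x in A | ~~ P x]|%:R = #|A|%:R - #|[set x in A | P x]|%:R :> algC.
Proof.
apply: canRL (addrK _) _; rewrite -natrD addnC -(cardsID [set x | P x] A).
congr (_ + _)%:R; apply: eq_card => x; first by rewrite !inE.
by rewrite !inE andbC.
Qed.

(** * The Grassmann graph through common hyperplanes *)

Section GrassmannGraph.
Variables (F : finFieldType) (n : nat).
Local Notation q := (#|F|%:R : algC).
Implicit Types (A B H I U V W Y Z : 'M[F]_n) (d : nat).
Let q_gt1 := cardF_gt1 F.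

Definition hplanes U : {set 'M[F]_n} :=
  [set Z | [&& <<Z>>%MS == Z, (Z <= U)%MS & (\rank Z).+1 == \rank U]].

Lemma hplanesP U Z :
  reflect [/\ <<Z>>%MS = Z, (Z <= U)%MS & (\rank Z).+1 = \rank U] (Z \in hplanes U).
Proof.
rewrite inE; apply: (iffP and3P) => [[/eqP ? ? /eqP ?] //|[-> -> ->]].
by rewrite !eqxx.
Qed.

Lemma card_hplanes_above U I : <<U>>%MS = U -> <<I>>%MS = I -> (I <= U)%MS ->
  #|[set H in hplanes U | (I <= H)%MS]|%:R = qint q (\rank U - \rank I).
Proof.
move=> gU gI sIU; case rU: (\rank U) => [|d].
  rewrite sub0n /qint big_ord0; apply/eqP; rewrite pnatr_eq0; apply/eqP/eq_card0 => H.
  by rewrite !inE rU !andbF.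
rewrite -rU -(@card_below _ _ U I d) //; congr (_%:R); apply: eq_card => H.
by rewrite !inE rU eqSS.
Qed.

Lemma card_hplanes U : <<U>>%MS = U -> #|hplanes U|%:R = qint q (\rank U).
Proof.
move=> gU; have := @card_hplanes_above U 0 gU (genmx0 _ _ _) (sub0mx _ _).
rewrite mxrank0 subn0 => <-; congr (_%:R); apply: eq_card => H.
by rewrite [RHS]inE sub0mx andbT.
Qed.

(** A common hyperplane of two distinct spaces must be their meet. So the number of common
    hyperplanes is, off the diagonal, the adjacency matrix of the Grassmann graph. *)
Lemma card_hplanesI Y Y' U V d : U \in grass Y d -> V \in grass Y' d -> U != V ->
  #|hplanes U :&: hplanes V| = ((\rank (U :&: V)).+1 == d).
Proof.
move=> gU gV; have /grassP[gU' UY rU] := gU; have /grassP[gV' VY rV] := gV.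
move=> /eqP neUV; have lt_d : (\rank (U :&: V) < d)%N.
  rewrite ltn_neqAle -{2}rU mxrankS ?capmxSl // andbT; apply: contra_notN neUV => /eqP rI.
  have sUV : (U <= U :&: V)%MS.
    by rewrite -(geq_leqif (mxrank_leqif_sup (capmxSl U V))) rU rI.
  by apply: (grass_sub_eq gU gV); rewrite (submx_trans sUV) ?capmxSr.
case: eqP => [e_d|ne_d]; last first.
  apply: eq_card0 => Z; rewrite !inE; apply/negP => /andP[/and3P[_ ZU /eqP rZ] /and3P[_ ZV _]].
  have : (\rank Z <= \rank (U :&: V))%N by rewrite mxrankS // sub_capmx ZU.
  by move: rZ; rewrite rU; lia.
rewrite -[RHS](cards1 <<(U :&: V)%MS>>%MS); apply: eq_card => Z; rewrite in_set1 in_setI.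
apply/andP/eqP => [[/hplanesP[gZ ZU rZ] /hplanesP[_ ZV _]]| ->].
  by apply: genmx_sub_eq; rewrite ?genmx_id // genmxE ?sub_capmx ?ZU //; lia.
by split; apply/hplanesP; rewrite genmx_id !genmxE ?capmxSl ?capmxSr e_d ?rU ?rV.
Qed.

Lemma card_hplanes_super Y Z d : Z \in grass Y d ->
  #|[set U in grass Y d.+1 | Z \in hplanes U]|%:R = qint q (\rank Y - d).
Proof.
case/grassP=> gZ ZY rZ; rewrite -rZ -card_above //; congr (_%:R).
apply: eq_card => U; rewrite [LHS]inE [RHS]inE; case: grassP => //= -[_ _ rU].
by rewrite inE rU gZ !eqxx andbT.
Qed.

(** Induction on [d]: counting the flags Z < U of dimensions d and d+1 from both ends gives the
    recursion [qbinomS]. *)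
Lemma card_grass Y d : (d <= \rank Y)%N -> #|grass Y d|%:R = qbinom q (\rank Y) d.
Proof.
elim: d => [|d IHd] le_d.
  rewrite (qbinom0 q_gt1) (_ : #|_| = 1%N) // -(cards1 (0 : 'M[F]_n)); apply: eq_card => A.
  rewrite [RHS]inE; apply/grassP/eqP => [[_ _ /eqP]|->]; first by rewrite mxrank_eq0 => /eqP.
  by rewrite genmx0 sub0mx mxrank0.
apply: (mulIf (qint_neq0 q_gt1 (ltn0Sn d))).
rewrite (qbinomS q_gt1 le_d) -(IHd (ltnW le_d)).
transitivity (\sum_(U in grass Y d.+1) \sum_(Z in grass Y d | Z \in hplanes U) 1 : algC).
  rewrite mulr_natl -sumr_const; apply: eq_bigr => U gU; have /grassP[gU' UY rU] := gU.
  rewrite -rU -card_hplanes // -sum1_card natr_sum; apply: eq_bigl => Z.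
  apply/idP/andP => [hZ|[]//]; split=> //; have /hplanesP[gZ ZU rZ] := hZ.
  by apply/grassP; rewrite (submx_trans ZU UY); split=> //; lia.
rewrite (exchange_big_dep (mem (grass Y d))) /=; last by move=> ? ? _ /andP[].
rewrite mulr_natl -sumr_const; apply: eq_bigr => Z gZ; rewrite -(card_hplanes_super gZ).
rewrite -sum1_card natr_sum; apply: eq_bigl => U; by rewrite inE gZ.
Qed.

(** A space V above Z either lies in U + Z, so that U + V = U + Z and the meet with U gains one
    dimension, or it enlarges U + Z and the meet keeps dimension s. [card_above] counts the first
    kind. *)
Lemma sum_super (M : nat) Y U Z (h : nat -> algC) :
  U \in grass Y M.+1 -> Z \in grass Y M ->
  let s := \rank (U :&: Z)%MS in
  \sum_(V in grass Y M.+1 | Z \in hplanes V) h (M.+1 - \rank (U :&: V))%N =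
  qint q (M.+1 - s) * h (M - s)%N
  + (qint q (\rank Y - M) - qint q (M.+1 - s)) * h (M.+1 - s)%N.
Proof.
move=> gU gZ s; have /grassP[gU' UY rU] := gU; have /grassP[gZ' ZY rZ] := gZ.
have r_sum := mxrank_sum_cap U Z; rewrite rU rZ -/s in r_sum.
have le_s : (s <= M)%N by rewrite -rZ mxrankS ?capmxSr.
rewrite (bigID (fun V => (V <= U + Z)%MS)) /=.
have inE1 : #|[set V in grass Y M.+1 | (Z \in hplanes V) && (V <= U + Z)%MS]|%:R =
    qint q (M.+1 - s).
  have -> : (M.+1 - s = \rank (U + Z)%MS - \rank Z)%N by rewrite rZ; lia.
  have <- : \rank <<(U + Z)%MS>>%MS = \rank (U + Z) by rewrite genmxE.
  rewrite -card_above ?genmxE ?addsmxSr // rZ; congr (_%:R).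
  apply: eq_card => V; rewrite !inE genmxE rZ gZ' eqxx /= [M.+1 == _]eq_sym.
  case rV: (\rank V == M.+1); rewrite ?andbF //= !andbT.
  case ZV: (Z <= V)%MS; rewrite ?andbF //= !andbT.
  case sV: (V <= U + Z)%MS; rewrite ?andbF //= ?andbT.
  by rewrite (submx_trans sV) ?addsmx_sub ?UY // andbT.
rewrite (eq_bigr (fun _ => h (M - s)%N)); last first.
  move=> V /andP[/andP[/grassP[gV VY rV] /hplanesP[_ ZV _]] sV]; congr h.
  have := mxrank_sum_cap U V; rewrite rU rV.
  have -> : \rank (U + V) = \rank (U + Z).
    by apply: eqmx_rank; rewrite !addsmx_sub !addsmxSl sV (submx_trans ZV) ?addsmxSr.
  lia.
rewrite [X in _ + X](eq_bigr (fun _ => h (M.+1 - s)%N)); last first.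
  move=> V /andP[/andP[/grassP[gV VY rV] /hplanesP[_ ZV _]] sV]; congr (h (_ - _)%N).
  have := mxrank_sum_cap U V; rewrite rU rV.
  have le1 : (s <= \rank (U :&: V))%N by rewrite mxrankS // capmxS.
  have : (\rank (U + Z) < \rank (U + V))%N.
    rewrite ltn_neqAle mxrankS ?addsmxS // andbT; apply: contra sV => /eqP e.
    have := mxrank_leqif_sup (addsmxS (submx_refl U) ZV); rewrite e => -[_].
    by rewrite eqxx => /esym; apply: submx_trans; rewrite addsmxSr.
  lia.
rewrite !sum_const_natl; congr (_ * _ + _ * _).
  by rewrite -inE1; congr (_%:R); apply: eq_card => V; rewrite [LHS]inE [RHS]inE andbA.
rewrite -inE1 -(card_hplanes_super gZ).
have <- : #|[set V in [set V in grass Y M.+1 | Z \in hplanes V] | (V <= U + Z)%MS]| =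
  #|[set V in grass Y M.+1 | (Z \in hplanes V) && (V <= U + Z)%MS]|.
  by apply: eq_card => V; rewrite [LHS]inE [RHS]inE [in LHS]inE andbA.
rewrite -card_setIN; congr (_%:R); apply: eq_card => V.
by rewrite [LHS]inE [RHS]inE [in RHS]inE.
Qed.

(** A step goes down to a hyperplane Z of V, then up to W. Of the [M] hyperplanes, [i] contain U
    meet V and keep the meet with U; the others lower its dimension by one. [sum_super] handles the
    way up. *)
Lemma grass_walk (M : nat) Y U V (h : nat -> algC) :
  U \in grass Y M -> V \in grass Y M ->
  let i := (M - \rank (U :&: V))%N in
  \sum_(W in grass Y M) #|hplanes V :&: hplanes W|%:R * h (M - \rank (U :&: W))%N =
  walk q M (\rank Y - M) h i + qint q M * qint q (\rank Y - M).+1 * h i.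
Proof.
move=> gU gV i; have /grassP[gU' UY rU] := gU; have /grassP[gV' VY rV] := gV.
case: M => [|M] in gU gV i rU rV *.
  have q0 : qint q 0 = 0 by rewrite /qint big_ord0.
  rewrite /walk q0; transitivity (0 : algC); last by ring.
  apply: big1 => W _; rewrite [hplanes V](_ : _ = set0) ?set0I ?cards0 ?mul0r //.
  by apply/setP => Z; rewrite !inE rV !andbF.
have M_le : (M.+1 <= \rank Y)%N by rewrite -rU mxrankS.
have -> : ((\rank Y - M.+1).+1 = \rank Y - M)%N by lia.
set i' := (M.+1 - _)%N in i *.
have r_le : (\rank (U :&: V) <= M.+1)%N by rewrite -rU mxrankS ?capmxSl.
have hplane_grass Z : Z \in hplanes V -> Z \in grass Y M.
  case/hplanesP=> gZ ZV rZ; apply/grassP; rewrite (submx_trans ZV VY); split=> //; lia.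
transitivity (\sum_(Z in hplanes V) \sum_(W in grass Y M.+1 | Z \in hplanes W)
     h (M.+1 - \rank (U :&: W))%N).
  rewrite (exchange_big_dep (mem (grass Y M.+1))) /=; last by move=> ? ? _ /andP[].
  apply: eq_bigr => W gW; rewrite sumr_const mulr_natl; congr (_ *+ _).
  by apply: eq_card => Z; rewrite inE gW.
under eq_bigr => Z hZ do rewrite (sum_super h gU (hplane_grass Z hZ)) /=.
pose I := <<(U :&: V)%MS>>%MS.
rewrite (bigID (fun Z => (I <= Z)%MS)) /=.
have cI : #|[set Z in hplanes V | (I <= Z)%MS]|%:R = qint q i.
  by rewrite card_hplanes_above ?genmx_id ?genmxE ?capmxSr // rV.
have cV : #|hplanes V|%:R = qint q M.+1 by rewrite card_hplanes // rV.
rewrite (eq_bigr (fun _ => qint q i * h i.-1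
     + (qint q (\rank Y - M) - qint q i) * h i)); last first.
  move=> Z /andP[/hplanesP[gZ ZV rZ]]; rewrite genmxE => IZ.
  have -> : \rank (U :&: Z) = \rank (U :&: V).
    apply: eqmx_rank; rewrite !sub_capmx !capmxSl IZ (submx_trans _ ZV) ?capmxSr //.
  have -> : (M - \rank (U :&: V) = i.-1)%N by rewrite /i /i'; lia.
  by [].
rewrite [X in _ + X](eq_bigr (fun _ => qint q i.+1 * h i
     + (qint q (\rank Y - M) - qint q i.+1) * h i.+1)); last first.
  move=> Z /andP[/hplanesP[gZ ZV rZ]]; rewrite genmxE => IZ.
  have r1 := mxrank_sum_cap (U :&: V)%MS Z.
  have r2 : (\rank ((U :&: V) + Z)%MS <= M.+1)%N.
    by rewrite -rV mxrankS // addsmx_sub capmxSr.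
  have r3 : (\rank Z < \rank ((U :&: V) + Z)%MS)%N.
    rewrite ltn_neqAle mxrankS ?addsmxSr // andbT; apply: contra IZ => /eqP e.
    have := mxrank_leqif_sup (addsmxSr (U :&: V)%MS Z); rewrite e => -[_].
    by rewrite eqxx => /esym; apply: submx_trans; rewrite addsmxSl.
  have r4 : \rank ((U :&: V) :&: Z) = \rank (U :&: Z).
    apply: eqmx_rank; rewrite !sub_capmx capmxSl !capmxSr (submx_trans (capmxSr U Z)) //.
    by rewrite !andbT (submx_trans (capmxSl _ _)) ?capmxSl.
  have -> : (M.+1 - \rank (U :&: Z) = i.+1)%N by rewrite -r4 /i /i'; lia.
  by have -> : (M - \rank (U :&: Z) = i)%N by rewrite -r4 /i /i'; lia.
rewrite !sum_const_natl.
have c1 : #|[set Z | (Z \in hplanes V) && (I <= Z)%MS]|%:R = qint q i.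
  by rewrite -cI; congr (_%:R); apply: eq_card => Z; rewrite !inE.
have c2 : #|[set Z | (Z \in hplanes V) && ~~ (I <= Z)%MS]|%:R = qint q M.+1 - qint q i.
  by rewrite -cI -cV -card_setIN.
rewrite c1 c2.
rewrite /walk -/i; have -> : ((\rank Y - M.+1).+1 = \rank Y - M)%N by lia.
ring.
Qed.

End GrassmannGraph.

(** * Transvections *)

Section Transvections.
Variables (F : finFieldType) (n : nat).
Local Notation q := (#|F|%:R : algC).
Implicit Types (A B H I U V W Y Z g : 'M[F]_n) (d : nat).
Implicit Types (f : 'cV[F]_n) (u v w : 'rV[F]_n) (p : 'cV[F]_n * 'rV[F]_n).
Let q_gt1 := cardF_gt1 F.

Definition gact U g : 'M[F]_n := <<U *m g>>%MS.

Lemma gactS U V g : (U <= V)%MS -> (gact U g <= gact V g)%MS.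
Proof. by move=> sUV; rewrite !genmxE submxMr. Qed.

Lemma rank_gact U g : g \in unitmx -> \rank (gact U g) = \rank U.
Proof. by move=> ug; rewrite genmxE mxrankMfree // row_free_unit. Qed.

Lemma gactM U g h : gact (gact U g) h = gact U (g *m h).
Proof. by apply/eq_genmx; rewrite mulmxA; apply: eqmxMr; apply: genmxE. Qed.

Lemma gact1 U : <<U>>%MS = U -> gact U 1%:M = U.
Proof. by rewrite /gact mulmx1. Qed.

Lemma gactK U g : <<U>>%MS = U -> g \in unitmx -> gact (gact U g) (invmx g) = U.
Proof. by move=> gU ug; rewrite gactM mulmxV // gact1. Qed.

Lemma gactVK U g : <<U>>%MS = U -> g \in unitmx -> gact (gact U (invmx g)) g = U.
Proof. by move=> gU ug; rewrite gactM mulVmx // gact1. Qed.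

Lemma genmx_gact U g : <<gact U g>>%MS = gact U g.
Proof. by rewrite genmx_id. Qed.

Lemma gact_grass U g d : g \in unitmx -> (gact U g \in grass 1%:M d) = (\rank U == d).
Proof. by move=> ug; rewrite inE genmx_gact eqxx submx1 rank_gact. Qed.

Lemma gact_hplanes Z U g : g \in unitmx -> Z \in hplanes U -> gact Z g \in hplanes (gact U g).
Proof.
by move=> ug /hplanesP[gZ ZU rZ]; apply/hplanesP; rewrite genmx_gact !rank_gact // gactS.
Qed.

Definition transv p : 'M[F]_n := 1%:M + p.1 *m p.2.
(** Pairs (f, u) count every nontrivial transvection q - 1 times and also include the identity; such
    constant weights leave the sum central. *)
Definition tpairs : {set 'cV[F]_n * 'rV[F]_n} := [set p | p.2 *m p.1 == 0].

Lemma mul_transv m (A : 'M_(m, n)) p : A *m transv p = A + A *m p.1 *m p.2.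
Proof. by rewrite mulmxDr mulmx1 mulmxA. Qed.

Lemma transv_unit p : p \in tpairs -> transv p \in unitmx.
Proof.
rewrite inE => /eqP uf0; have: transv p *m transv (- p.1, p.2) = 1%:M.
  rewrite mul_transv /= mulmxN {2}/transv mulmxDl mul1mx -mulmxA uf0 mulmx0 addr0.
  by rewrite mulNmx addrK.
by case/mulmx1_unit.
Qed.

Lemma card_annihilator m (A : 'M[F]_(m, n)) :
  #|[set f : 'cV[F]_n | A *m f == 0]| = (#|F| ^ (n - \rank A))%N.
Proof.
rewrite -(mxrank_tr A) -mxrank_ker -card_rowspace -(card_imset _ (@trmx_inj _ _ _)).
apply: eq_card => v; apply/imsetP/idP.
  by case=> f; rewrite !inE => /eqP Af0 ->; rewrite sub_kermx -trmx_mul Af0 trmx0.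
rewrite inE sub_kermx => vA; exists v^T; last by rewrite trmxK.
by rewrite inE -[A]trmxK -trmx_mul (eqP vA) trmx0.
Qed.

(** The transvection fixes the kernel of f pointwise, and that kernel meets U in codimension at most
    one. Hence U is moved to itself or to a neighbour in the Grassmann graph. *)
Lemma transv_fix_rank U p d : p \in tpairs -> \rank U = d.+1 ->
  (d <= \rank (U :&: kermx p.1))%N /\ ((U :&: kermx p.1) <= gact U (transv p))%MS.
Proof.
move=> pP rU; split.
  have := mxrank_sum_cap U (kermx p.1); rewrite mxrank_ker rU.
  have := rank_leq_col (U + kermx p.1)%MS; have := rank_leq_col p.1.
  have := rank_leq_row p.1; lia.
rewrite genmxE; set K := (_ :&: _)%MS.
have Kp : K *m p.1 = 0 by apply/sub_kermxP; rewrite capmxSr.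
have {1}-> : K = K *m transv p by rewrite mul_transv Kp mul0mx addr0.
by rewrite submxMr // capmxSl.
Qed.

Definition tcount U V := #|[set p in tpairs | gact U (transv p) == V]|.
(** This is q^(n-2) (q-1)^2, the number of pairs moving a space to a given neighbour. *)
Definition tbeta : algC := q ^+ n * (1 - q^-1) ^+ 2.

Lemma tcount_far U V d : U \in grass 1%:M d.+1 -> (\rank (U :&: V) < d)%N -> tcount U V = 0%N.
Proof.
move=> /grassP[_ _ rU] lt_r; apply: eq_card0 => p; rewrite inE; apply/negP => /andP[pP /eqP eV].
have [le_d] := transv_fix_rank pP rU; rewrite eV => sV.
have : (\rank (U :&: kermx p.1) <= \rank (U :&: V))%N by rewrite mxrankS // sub_capmx capmxSl.
by move/(leq_trans le_d); rewrite leqNgt lt_r.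
Qed.

Lemma mem_sub_rank A B (w : 'rV[F]_n) : (B <= A)%MS -> (w <= A)%MS -> ~~ (w <= B)%MS ->
  (\rank A <= (\rank B).+1)%N -> (A <= B + w)%MS.
Proof.
move=> BA wA wB le_r; rewrite -(geq_leqif (mxrank_leqif_sup _)) ?addsmx_sub ?BA //.
by rewrite mxrank_adds_row.
Qed.

(** Let H be the meet, w in U outside H and w' in V outside H. The form f must kill H and be nonzero
    at w and w', which leaves q^(n-d-2) (q-1)^2 choices; then u ranges over a coset of H, which
    leaves q^d. *)
Lemma tcount_near U V d : U \in grass 1%:M d.+1 -> V \in grass 1%:M d.+1 ->
  \rank (U :&: V) = d -> (tcount U V)%:R = tbeta.
Proof.
move=> /grassP[gU _ rU] /grassP[gV _ rV] rH; set H := (U :&: V)%MS in rH.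
have HU : (H <= U)%MS by apply: capmxSl. have HV : (H <= V)%MS by apply: capmxSr.
have [i wU wH] : exists2 w : 'rV[F]_n, (w <= U)%MS & ~~ (w <= H)%MS.
  have /row_subPn[i Hi] : ~~ (U <= H)%MS.
    by apply/negP => /mxrankS; rewrite rU rH ltnn.
  by exists (row i U); rewrite ?row_sub.
move: i wU wH => w wU wH.
have [w' wV' wH'] : exists2 w : 'rV[F]_n, (w <= V)%MS & ~~ (w <= H)%MS.
  have /row_subPn[i Hi] : ~~ (V <= H)%MS.
    by apply/negP => /mxrankS; rewrite rV rH ltnn.
  by exists (row i V); rewrite ?row_sub.
have sU : (U <= H + w)%MS by rewrite mem_sub_rank ?rU ?rH.
have sV : (V <= H + w')%MS by rewrite mem_sub_rank ?rV ?rH.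
have wV : ~~ (w <= V)%MS by apply: contra wH => wV; rewrite sub_capmx wU.
pose good := [set f : 'cV[F]_n | [&& H *m f == 0, w *m f != 0 & w' *m f != 0]].
pose E := [set p | [&& p.2 *m p.1 == 0, H *m p.1 == 0 & (w *m transv p <= V)%MS]].
have e_set : [set p in tpairs | gact U (transv p) == V] = E.
  apply/setP => p; rewrite [LHS]inE [RHS]inE; case pP: (p \in tpairs); last first.
    by move: pP; rewrite inE => ->.
  move: (pP); rewrite inE => -> /=; apply/eqP/andP => [eV|[/eqP Hf wt]].
    have [le_d] := transv_fix_rank pP rU; rewrite eV => sKV.
    have sKH : (U :&: kermx p.1 <= H)%MS by rewrite sub_capmx capmxSl.
    have sHK : (H <= U :&: kermx p.1)%MS.
      by rewrite -(geq_leqif (mxrank_leqif_sup sKH)) rH.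
    split; first by rewrite -sub_kermx (submx_trans sHK) ?capmxSr.
    by rewrite -eV genmxE submxMr.
  apply: genmx_sub_eq; rewrite ?genmx_gact ?rank_gact ?transv_unit ?rU ?rV //.
  rewrite genmxE (submx_trans (submxMr _ sU)) // addsmxMr addsmx_sub wt andbT.
  by rewrite mul_transv Hf mul0mx addr0.
rewrite /tcount e_set -sum1_card.
have -> : (\sum_(p in E) 1 = \sum_(f in good) #|F| ^ d)%N.
  rewrite (eq_bigl (fun p : 'cV[F]_n * 'rV[F]_n =>
    (H *m p.1 == 0) && ((p.2 *m p.1 == 0) && (w *m transv p <= V)%MS)));
    last by move=> p; rewrite inE andbCA.
  rewrite -(pair_big_dep (fun f : 'cV[F]_n => H *m f == 0)
    (fun (f : 'cV[F]_n) (u : 'rV[F]_n) => (u *m f == 0) && (w *m transv (f, u) <= V)%MS)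
    (fun _ _ => 1%N)) /=.
  rewrite [RHS](eq_bigl (fun f : 'cV[F]_n =>
    (H *m f == 0) && ((w *m f != 0) && (w' *m f != 0)))); last first.
    by move=> f; rewrite inE.
  rewrite [RHS]big_mkcondr; apply: eq_bigr => f /eqP Hf.
  case: (eqVneq (w *m f) 0) => [wf0|wf] /=.
    apply: big1 => u /andP[_]; rewrite mul_transv /= wf0 mul0mx addr0.
    by rewrite (negPf wV).
  set c := (w *m f) 0 0; have wfE : w *m f = c%:M by rewrite [LHS]mx11_scalar.
  have c0 : c != 0 by apply: contra wf; rewrite wfE => /eqP->; rewrite raddf0.
  have wtE u : w *m transv (f, u) = w + c *: u by rewrite mul_transv /= wfE mul_scalar_mx.
  case: (eqVneq (w' *m f) 0) => [w'f0|w'f] /=.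
    apply: big1 => u /andP[/eqP uf0]; rewrite wtE => sV'; case/negP: wf.
    have : ((w + c *: u) *m f <= (H + w')%MS *m f)%MS by rewrite submxMr // (submx_trans sV').
    by rewrite addsmxMr Hf w'f0 adds0mx submx0 mulmxDl -scalemxAl uf0 scaler0 addr0.
  set c' := (w' *m f) 0 0; have w'fE : w' *m f = c'%:M by rewrite [LHS]mx11_scalar.
  have c'0 : c' != 0 by apply: contra w'f; rewrite w'fE => /eqP->; rewrite raddf0.
  rewrite sum1_card -rH -card_rowspace.
  (* The vector w + c u lies in V, so it is z plus a multiple of w' with z in H; applying f, which
     kills u and H, forces the multiple to be c / c'. Solving for u gives [k]. *)
  pose k (z : 'rV[F]_n) := c^-1 *: (z + (c / c') *: w' - w).
  have k_inj : injective k.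
    move=> a b /(scalerI _); rewrite invr_eq0 => /(_ c0) /addIr /addIr; exact.
  rewrite -[RHS](card_imset _ k_inj); apply: eq_card => u; rewrite [LHS]unfold_in.
  have ck z : w + c *: k z = z + (c / c') *: w'.
    by rewrite scalerA mulfV // scale1r addrC subrK.
  have kf z : (z <= H)%MS -> k z *m f = 0.
    case/submxP=> D ->; rewrite -scalemxAl mulmxBl mulmxDl -mulmxA Hf mulmx0 add0r.
    rewrite -scalemxAl w'fE wfE scale_scalar_mx mulfVK //.
    by rewrite subrr scaler0.
  apply/andP/imsetP => [[/eqP uf0]|[z]]; last first.
    rewrite inE => zH ->; rewrite kf // eqxx wtE ck; split=> //.
    by rewrite addmx_sub ?(submx_trans zH) ?scalemx_sub.
  rewrite wtE => sV'; exists (w + c *: u - (c / c') *: w'); last first.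
    by rewrite /k subrK addrAC subrr add0r scalerA mulVf // scale1r.
  rewrite inE; set z := _ - _.
  have zV : (z <= V)%MS by rewrite addmx_sub // eqmx_opp scalemx_sub.
  have zf : z *m f = 0.
    rewrite mulmxBl mulmxDl -!scalemxAl uf0 scaler0 addr0 w'fE wfE scale_scalar_mx.
    by rewrite mulfVK // subrr.
  have := submx_trans zV sV; case/sub_addsmxP=> -[D1 D2] /= ez.
  move: zf; rewrite ez mulmxDl -!mulmxA Hf mulmx0 add0r w'fE => /eqP.
  rewrite mul_mx_scalar scaler_eq0 (negPf c'0) => /eqP ->.
  by rewrite mul0mx addr0 submxMl.
rewrite sum_nat_const natrM.
have w'U : ~~ (w' <= H + w)%MS.
  apply: contra wH' => w'Hw; rewrite sub_capmx wV' andbT (submx_trans w'Hw) //.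
  by rewrite addsmx_sub HU.
have r_Hw : \rank (H + w) = d.+1 by rewrite mxrank_adds_row // rH.
have r_all : (d.+2 <= n)%N by rewrite -r_Hw -(mxrank_adds_row w'U) rank_leq_col.
have cH : #|[set f : 'cV[F]_n | H *m f == 0]| = (#|F| ^ (n - d))%N by rewrite card_annihilator rH.
have cHv (A : 'M[F]_n) (v : 'rV[F]_n) : ~~ (v <= A)%MS ->
    #|[set f in [set f : 'cV[F]_n | A *m f == 0] | v *m f == 0]| = (#|F| ^ (n - (\rank A).+1))%N.
  move=> vA; transitivity #|[set f : 'cV[F]_n | (A + v)%MS *m f == 0]|.
    by apply: eq_card => f; rewrite !inE -!sub_kermx addsmx_sub.
by rewrite card_annihilator mxrank_adds_row.
have c3 : #|[set f in [set f in [set f : 'cV[F]_n | H *m f == 0] | w' *m f == 0] | w *m f == 0]|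
     = (#|F| ^ (n - d.+2))%N.
  rewrite -r_Hw -(cHv _ _ w'U); apply: eq_card => f.
  by rewrite !inE -[in RHS]sub_kermx addsmx_sub !sub_kermx andbAC.
(* Inclusion-exclusion over f vanishing at w or at w'. As w' is not in H + w, the annihilators of H,
   H + w, H + w' and H + w + w' have dimensions n-d, n-d-1, n-d-1 and n-d-2. *)
have -> : #|good|%:R = q ^+ (n - d) - q ^+ (n - d.+1) - (q ^+ (n - d.+1) - q ^+ (n - d.+2)).
  rewrite -!natrX -c3 -cH -{1}rH -(cHv _ _ wH) -card_setIN -rH -(cHv _ _ wH') -!card_setIN.
  have <- : #|[set f in [set f in [set f : 'cV[F]_n | H *m f == 0] | w *m f != 0] | w' *m f == 0]| =
      #|[set f in [set f in [set f : 'cV[F]_n | H *m f == 0] | w' *m f == 0] | w *m f != 0]|.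
    by apply: eq_card => f; rewrite !inE andbAC.
  rewrite -card_setIN; congr (_%:R); apply: eq_card => f.
  by rewrite !inE andbA.
rewrite natrX /tbeta; set e := (n - d.+2)%N.
have [-> ->] : (n - d = e.+2 /\ n - d.+1 = e.+1)%N by rewrite /e; lia.
have -> : q ^+ n = q ^+ d * q ^+ e * q ^+ 2.
  by rewrite -!exprD; congr (_ ^+ _); rewrite /e; lia.
have q0 := q_neq0 q_gt1; rewrite !exprS; move: (q ^+ e) (q ^+ d) => a b.
by field.
Qed.

Lemma tcount_neq U V d : U \in grass 1%:M d -> V \in grass 1%:M d -> U != V ->
  (tcount U V)%:R = tbeta * #|hplanes U :&: hplanes V|%:R.
Proof.
move=> gU gV neUV; rewrite (card_hplanesI gU gV neUV).
have [gU' _ rU] := grassP _ _ _ gU.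
have le_d : (\rank (U :&: V) <= d)%N by rewrite -rU mxrankS ?capmxSl.
case: d => [|d] in gU gV rU le_d *.
  case/eqP: neUV; have gs := grass_sub_eq gU gV; apply: gs.
  by move/eqP: rU; rewrite mxrank_eq0 => /eqP->; apply: sub0mx.
rewrite eqSS; case: eqP => [rI|/eqP rI]; first by rewrite (tcount_near gU gV rI) mulr1.
have lt_d1 : (\rank (U :&: V) < d.+1)%N.
  rewrite ltn_neqAle le_d andbT; apply: contra neUV => /eqP r1.
  apply/eqP/(grass_sub_eq gU gV); have := mxrank_leqif_sup (capmxSl U V).
  by rewrite rU r1 => -[_]; rewrite eqxx => /esym sUV; rewrite (submx_trans sUV) ?capmxSr.
by rewrite (@tcount_far U V d) ?mulr0 // ltn_neqAle rI.
Qed.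

(** The diagonal correction in [tcountE], forced by the fact that every row of [tcount] sums to
    [#|tpairs|]. It reappears as the scalar by which the transvection sum acts on [spec_char d]. *)
Definition tgamma d : algC := #|tpairs|%:R - tbeta * (qint q d * qint q (n - d).+1).

Lemma sum_card_hplanesI d U : U \in grass 1%:M d ->
  \sum_(V in grass 1%:M d) #|hplanes U :&: hplanes V|%:R = qint q d * qint q (n - d).+1.
Proof.
move=> gU; have := grass_walk (fun=> 1) gU gU; rewrite /= mxrank1 /walk !subrr !mulr0 !add0r mulr1.
by move=> <-; apply: eq_bigr => V _; rewrite mulr1.
Qed.

Lemma sum_tcount (h : 'M[F]_n -> algC) d U : U \in grass 1%:M d ->
  \sum_(p in tpairs) h (gact U (transv p)) = \sum_(V in grass 1%:M d) (tcount U V)%:R * h V.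
Proof.
move=> gU; rewrite (partition_big (fun p => gact U (transv p)) (mem (grass 1%:M d))) /=.
  apply: eq_bigr => V gV; rewrite (eq_bigr (fun=> h V)) => [|p /andP[_ /eqP->]//].
  by rewrite sum_const_natl; congr (_%:R * _); apply: eq_card => p; rewrite !inE.
by move=> p pP; rewrite gact_grass ?transv_unit //; case/grassP: gU => _ _ ->.
Qed.

Lemma tcountE U V d : U \in grass 1%:M d -> V \in grass 1%:M d ->
  (tcount U V)%:R = tbeta * #|hplanes U :&: hplanes V|%:R + tgamma d * (U == V)%:R.
Proof.
move=> gU gV; case: (eqVneq U V) => [eUV|neUV]; last first.
  by rewrite mulr0 addr0 (tcount_neq gU gV).
move: gV; rewrite -eUV => _; have [gU' _ rU] := grassP _ _ _ gU.
have := sum_tcount (fun=> 1) gU.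
rewrite sumr_const (bigD1 U) //= => e_sum.
have := sum_card_hplanesI gU; rewrite (bigD1 U) //= setIid card_hplanes // rU => e_hyp.
rewrite (eq_bigr (fun V => tbeta * #|hplanes U :&: hplanes V|%:R)) in e_sum; last first.
  by move=> W /andP[gW neWU]; rewrite mulr1 (tcount_neq gU gW) // eq_sym.
move: e_sum; rewrite -mulr_sumr mulr1 mulr1 /tgamma -e_hyp => ->.
ring.
Qed.

(** Two distinct spaces have a common hyperplane exactly when their sum is one dimension larger, and
    each is then unique. So going up then down differs from going down then up only on the
    diagonal. *)
Lemma card_super2 Z Z' d : Z \in grass 1%:M d -> Z' \in grass 1%:M d ->
  #|[set U in grass 1%:M d.+1 | (Z \in hplanes U) && (Z' \in hplanes U)]|%:R =
  #|hplanes Z :&: hplanes Z'|%:R + (qint q (n - d) - qint q d) * (Z == Z')%:R.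
Proof.
move=> gZ gZ'; have [hZ _ rZ] := grassP _ _ _ gZ; have [hZ' _ rZ'] := grassP _ _ _ gZ'.
case: (eqVneq Z Z') => [<-|neZ].
  rewrite setIid mulr1 card_hplanes // rZ addrC subrK -[in RHS](mxrank1 F n)
     -(card_hplanes_super gZ).
  by congr (_%:R); apply: eq_card => U; rewrite !inE andbb.
rewrite mulr0 addr0 (card_hplanesI gZ gZ' neZ).
have r_sum := mxrank_sum_cap Z Z'; rewrite rZ rZ' in r_sum.
have lt_d : (d < \rank (Z + Z'))%N.
  rewrite ltnNge; apply: contra neZ => le_d; apply/eqP/esym/(grass_sub_eq gZ' gZ).
  have sZ : (Z + Z' <= Z)%MS by rewrite -(geq_leqif (mxrank_leqif_sup (addsmxSl Z Z'))) rZ.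
  exact: submx_trans (addsmxSr Z Z') sZ.
case: eqP => [rI|rI]; last first.
  rewrite (_ : #|_| = 0)%N //; apply: eq_card0 => U; rewrite inE; apply/negP.
  case/and3P=> [/grassP[_ _ rU] /hplanesP[_ ZU _] /hplanesP[_ ZU' _]].
  have : (\rank (Z + Z') <= \rank U)%N by rewrite mxrankS // addsmx_sub ZU.
  rewrite rU; lia.
rewrite (_ : #|_| = 1)%N // -(cards1 <<(Z + Z')%MS>>%MS).
apply: eq_card => U; rewrite in_set1 inE; apply/and3P/eqP.
  case=> [/grassP[gU _ rU] /hplanesP[_ ZU _] /hplanesP[_ ZU' _]].
  apply/esym/genmx_sub_eq; rewrite ?genmx_id // genmxE ?addsmx_sub ?ZU // rU; lia.
move=> ->; have r_s : \rank (Z + Z') = d.+1 by lia.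
split; first by rewrite grass_genmx submx1 r_s eqxx.
  by apply/hplanesP; rewrite !genmxE addsmxSl rZ r_s.
by apply/hplanesP; rewrite !genmxE addsmxSr rZ' r_s.
Qed.

End Transvections.

(** * Spherical kernels *)

Section Characters.
Variables (F : finFieldType) (n : nat).
Local Notation q := (#|F|%:R : algC).
Implicit Types (A B H I U V W Y Z g k : 'M[F]_n) (d m x : nat).
Let q_gt1 := cardF_gt1 F.

Definition grass_char d g : algC := #|[set U in grass 1%:M d | gact U g == U]|%:R.
(** The trace of [g] composed with the common-hyperplane operator on [d]-spaces. *)
Definition hplane_char d g : algC :=
  \sum_(U in grass 1%:M d) #|hplanes (gact U g) :&: hplanes U|%:R.
Definition spec_char x g : algC := grass_char x g - (if x is x'.+1 then grass_char x' g else 0).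

Lemma grass_charE d g : grass_char d g = \sum_(U in grass 1%:M d) (gact U g == U)%:R.
Proof.
rewrite (eq_bigr (fun U => if gact U g == U then 1 else 0)) => [|U _]; last by case: eqP.
by rewrite -big_mkcondr /= sum_const_natl mulr1.
Qed.

Lemma gact_inj g U V : <<U>>%MS = U -> <<V>>%MS = V -> g \in unitmx ->
  gact U g = gact V g -> U = V.
Proof. by move=> gU gV ug e; rewrite -(gactK gU ug) e gactK. Qed.

Lemma hplanes_gactE g U Z : <<U>>%MS = U -> <<Z>>%MS = Z -> g \in unitmx ->
  (gact Z g \in hplanes (gact U g)) = (Z \in hplanes U).
Proof.
move=> gU gZ ug; apply/idP/idP => [|hZ]; last exact: gact_hplanes.
by move/(gact_hplanes (g := invmx g)); rewrite unitmx_inv ug !gactK // => ->.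
Qed.

(** Both sides count the pairs (Z, U) for which Z and its image under [g] are hyperplanes of U: over
    a fixed U these images are the common hyperplanes of U and its image, and over a fixed Z
    [card_super2] applies. *)
Lemma hplane_charS d g : g \in unitmx ->
  hplane_char d.+1 g = hplane_char d g + (qint q (n - d) - qint q d) * grass_char d g.
Proof.
move=> ug; transitivity (\sum_(U in grass 1%:M d.+1)
    \sum_(Z in grass 1%:M d | (Z \in hplanes U) && (gact Z g \in hplanes U)) 1 : algC).
  apply: eq_bigr => U /grassP[gU _ rU]; rewrite sum_const_natl mulr1; congr (_%:R).
  rewrite -[RHS](card_in_imset (f := fun Z => gact Z g)) => [|A B]; last first.
    rewrite !inE => /andP[/and3P[/eqP gA _ _] _] /andP[/and3P[/eqP gB _ _] _].
    exact: gact_inj.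
  apply: eq_card => Z; rewrite in_setI; apply/andP/imsetP => [[hZ1 hZ2]|[Z' hZ' ->]].
    have [gZ ZU rZ] := hplanesP _ _ hZ1.
    exists (gact Z (invmx g)); last by rewrite gactVK.
    rewrite inE gact_grass ?unitmx_inv // gactVK // hZ2 andbT.
    rewrite -(@hplanes_gactE g) ?genmx_gact ?gactVK // hZ1 andbT.
    by move: rZ; rewrite rank_gact // rU => -[->].
  move: hZ'; rewrite inE => /andP[_ /andP[hZ hZg]]; split=> //.
  exact: gact_hplanes.
rewrite (exchange_big_dep (mem (grass 1%:M d))) /=; last by move=> ? ? _ /andP[].
transitivity (\sum_(Z in grass 1%:M d) (#|hplanes (gact Z g) :&: hplanes Z|%:R
   + (qint q (n - d) - qint q d) * (Z == gact Z g)%:R)).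
  apply: eq_bigr => Z gZ; have [gZ' _ rZ] := grassP _ _ _ gZ.
  rewrite setIC -card_super2 ?gact_grass ?rZ // sum_const_natl mulr1; congr (_%:R).
  by apply: eq_card => U; rewrite [LHS]inE [RHS]inE gZ.
rewrite big_split /= -mulr_sumr; congr (_ + _ * _).
by rewrite grass_charE; apply: eq_bigr => Z _; rewrite eq_sym.
Qed.

Lemma sum_grass_char_transv d g : g \in unitmx ->
  \sum_(p in tpairs F n) grass_char d (g *m transv p) =
  tbeta F n * hplane_char d g + tgamma F n d * grass_char d g.
Proof.
move=> ug; rewrite /grass_char.
transitivity (\sum_(U in grass 1%:M d) (tcount (gact U g) U)%:R : algC).
  transitivity (\sum_(p in tpairs F n) \sum_(U in grass 1%:M d |
      gact (gact U g) (transv p) == U) 1 : algC).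
    apply: eq_bigr => p _; rewrite sum_const_natl mulr1; congr (_%:R).
    by apply: eq_card => U; rewrite !inE gactM.
  rewrite (exchange_big_dep (mem (grass 1%:M d))) /=; last by move=> ? ? _ /andP[].
  apply: eq_bigr => U gU; rewrite sum_const_natl mulr1; congr (_%:R).
  by apply: eq_card => p; rewrite [LHS]inE [RHS]inE gU.
rewrite /hplane_char -/(grass_char d g) grass_charE !mulr_sumr -big_split /=.
apply: eq_bigr => U gU; have [_ _ rU] := grassP _ _ _ gU.
by rewrite (@tcountE _ _ _ _ d) ?gact_grass ?rU.
Qed.

Lemma tgammaS d : (d < n)%N ->
  tgamma F n d.+1 = tgamma F n d - tbeta F n * (qint q (n - d) - qint q d).
Proof.
move=> lt_d; rewrite /tgamma subnSK //; have qS e : qint q e.+1 = 1 + q * qint q e.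
  rewrite /qint big_ord_recl expr0 mulr_sumr; congr (_ + _).
  by apply: eq_bigr => i _; rewrite lift0 exprS.
rewrite !qS; ring.
Qed.

(** By [hplane_charS] the trace terms for x and x-1 differ by a multiple of the smaller permutation
    character, and [tgammaS] says that this multiple turns [tgamma] at x-1 into [tgamma] at x. The
    difference of characters is therefore only scaled. *)
Lemma sum_spec_char_transv x g : (x <= n)%N -> g \in unitmx ->
  \sum_(p in tpairs F n) spec_char x (g *m transv p) = tgamma F n x * spec_char x g.
Proof.
move=> le_x ug; rewrite sumrB sum_grass_char_transv //; case: x le_x => [|d] le_d.
  rewrite big1 // (_ : hplane_char 0 g = 0) ?mulr0 ?add0r /spec_char ?subr0 //.
  apply: big1 => U /grassP[_ _ rU]; rewrite [hplanes U](_ : _ = set0) ?setI0 ?cards0 //.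
  by apply/setP => Z; rewrite !inE rU !andbF.
rewrite sum_grass_char_transv // hplane_charS // tgammaS // /spec_char; ring.
Qed.

Definition char_kernel x W V : algC := \sum_(g in GLset F n | gact W g == V) spec_char x g.

(** The sum of the kernel over transvections of V is evaluated twice: moved onto the group element
    it is a scalar by [sum_spec_char_transv], and grouped by the image of V it is the operator
    [tcountE]. The terms [#|tpairs|] cancel and [tbeta] divides out. *)
Lemma char_kernel_eigen m x W V : (m <= n)%N -> (x <= n)%N ->
    W \in grass 1%:M m -> V \in grass 1%:M m ->
  \sum_(V' in grass 1%:M m) #|hplanes V :&: hplanes V'|%:R * char_kernel x W V' =
  (qint q m * qint q (n - m).+1 - qint q x * qint q (n - x).+1) * char_kernel x W V.
Proof.
move=> le_m le_x gW gV; have [gW' _ rW] := grassP _ _ _ gW; have [gV' _ rV] := grassP _ _ _ gV.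
have : \sum_(p in tpairs F n) char_kernel x W (gact V (transv p)) =
    tgamma F n x * char_kernel x W V.
  transitivity (\sum_(p in tpairs F n) \sum_(g in GLset F n | gact W g == V)
    spec_char x (g *m transv p)).
    apply: eq_bigr => p pP; have ut := transv_unit pP.
    rewrite /char_kernel (reindex_inj (can_inj (mulmxK ut))) /=; apply: eq_bigl => g.
    rewrite !inE unitmx_mul ut andbT; congr (_ && _); rewrite -gactM.
    by apply/eqP/eqP => [/gact_inj -> //|->//]; rewrite ?genmx_gact.
  rewrite exchange_big /= mulr_sumr; apply: eq_bigr => g; rewrite inE => /andP[ug _].
  exact: sum_spec_char_transv.
rewrite (sum_tcount _ gV).
under eq_bigr => V' gV2 do rewrite (tcountE gV gV2) mulrDl -mulrA.
have e2 : \sum_(V' in grass 1%:M m) tgamma F n m * (V == V')%:R * char_kernel x W V' =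
    tgamma F n m * char_kernel x W V.
  rewrite (bigD1 V) //= eqxx mulr1 big1 ?addr0 // => V' /andP[_ neV].
  by rewrite eq_sym (negPf neV) mulr0 mul0r.
rewrite big_split /= -mulr_sumr e2 /tgamma => e.
have b0 : tbeta F n != 0.
  rewrite mulf_neq0 ?expf_neq0 ?(q_neq0 q_gt1) // subr_eq0 -(inj_eq (mulIf (q_neq0 q_gt1))).
  by rewrite mul1r mulVf ?(q_neq0 q_gt1) // gt_eqF.
apply: (mulfI b0); move/(canRL (addrK _)): e => ->; ring.
Qed.

Lemma grass_char_conj d g k : k \in unitmx -> grass_char d (invmx k *m g *m k) = grass_char d g.
Proof.
move=> uk; congr (_%:R); rewrite -[RHS](card_in_imset (f := fun Z => gact Z k)); last first.
  move=> A B; rewrite !inE => /andP[/and3P[/eqP gA _ _] _] /andP[/and3P[/eqP gB _ _] _].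
  exact: gact_inj.
apply: eq_card => U; apply/idP/imsetP => [|[U' sU' ->]].
  rewrite inE -mulmxA -!gactM => /andP[/grassP[gU _ rU] /eqP eU].
  exists (gact U (invmx k)); last by rewrite gactVK.
  rewrite inE gact_grass ?unitmx_inv // rU eqxx; apply/eqP.
  by rewrite -{2}eU gactK // genmx_gact.
have /andP[/grassP[gU _ rU] /eqP eU] : (U' \in grass 1%:M d) && (gact U' g == U').
  by move: sU'; rewrite inE.
by rewrite inE gact_grass // rU eqxx -mulmxA -!gactM gactK // eU eqxx.
Qed.

Lemma spec_char_conj x g k : k \in unitmx -> spec_char x (invmx k *m g *m k) = spec_char x g.
Proof. by move=> uk; rewrite /spec_char; case: x => [|x]; rewrite !grass_char_conj. Qed.

Lemma char_kernel_conj x W V k : <<W>>%MS = W -> <<V>>%MS = V -> k \in unitmx -> gact W k = W ->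
  char_kernel x W (gact V k) = char_kernel x W V.
Proof.
move=> gW gV uk Wk; rewrite /char_kernel.
have c_inj : injective (fun g => invmx k *m g *m k).
  by move=> a b /(can_inj (mulmxK uk)) /(can_inj (mulKVmx uk)).
rewrite (reindex_inj c_inj) /=; apply: eq_big => [g|g _]; last exact: spec_char_conj.
rewrite !inE !unitmx_mul unitmx_inv uk andbT /=; congr (_ && _).
rewrite -mulmxA -!gactM -{1}Wk gactK //.
by apply/eqP/eqP => [/gact_inj -> //|->//]; rewrite ?genmx_gact.
Qed.

Lemma exists_row_base A r : \rank A = r ->
  exists2 B : 'M[F]_(r, n), row_free B & (B :=: A)%MS.
Proof. by move=> <-; exists (row_base A); [apply: row_base_free | apply: eq_row_base]. Qed.

(* A basis of the meet, completed to bases of both subspaces, is a basis of the sum. *)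
Lemma pair_transitive W V W' V' :
    <<W>>%MS = W -> <<V>>%MS = V -> <<W'>>%MS = W' -> <<V'>>%MS = V' ->
    \rank W = \rank W' -> \rank V = \rank V' ->
    \rank (W :&: V) = \rank (W' :&: V') ->
  exists k, [/\ k \in unitmx, gact W k = W' & gact V k = V'].
Proof.
move=> gW gV gW' gV' rW rV rI.
pose a := \rank (W :&: V); pose c := \rank (W :\: V); pose d := \rank (V :\: W).
have rD A B A' B' : \rank A = \rank A' -> \rank (A :&: B) = \rank (A' :&: B') ->
    \rank (A' :\: B') = \rank (A :\: B).
  have := mxrank_cap_compl A B; have := mxrank_cap_compl A' B'; lia.
have rI' : \rank (V :&: W) = \rank (V' :&: W') by rewrite capmxC rI capmxC.
have basis A B : \rank (A :&: B) = a -> \rank (A :\: B) = c -> \rank (B :\: A) = d ->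
    exists R1 : 'M[F]_(a, n), exists R2 : 'M[F]_(c, n), exists R3 : 'M[F]_(d, n),
    [/\ (R1 + R2 :=: A)%MS, (R1 + R3 :=: B)%MS & row_free (col_mx (col_mx R1 R2) R3)].
  move=> ra rc rd; have [R1 _ e1] := exists_row_base ra.
  have [R2 _ e2] := exists_row_base rc; have [R3 _ e3] := exists_row_base rd.
  have eA : (R1 + R2 :=: A)%MS.
    apply: eqmx_trans (addsmx_diff_cap_eq A B); rewrite addsmxC.
    exact: adds_eqmx.
  have eB : (R1 + R3 :=: B)%MS.
    apply: eqmx_trans (addsmx_diff_cap_eq B A); rewrite addsmxC.
    by apply: adds_eqmx => //; rewrite capmxC.
  exists R1, R2, R3; split=> //; rewrite /row_free -addsmxE.
  have -> : \rank (col_mx R1 R2 + R3) = \rank (A + B).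
    have s12 : (R1 + R2 <= col_mx R1 R2 + R3)%MS by rewrite addsmxE addsmxSl.
    apply: eqmx_rank; rewrite !addsmx_sub -!addsmxE eA addsmxSl /=.
    rewrite (submx_trans (addsmxSr R1 R3)) ?eB ?addsmxSr //= -eA -eB !addsmx_sub.
    by rewrite addsmxSr !andbT !(submx_trans _ s12) ?addsmxSl ?addsmxSr.
  have h1 := mxrank_sum_cap A B; have h2 := mxrank_cap_compl A B.
  have h3 := mxrank_cap_compl B A; rewrite (capmxC B A) in h3.
  rewrite ra rc in h2; rewrite ra rd in h3; rewrite ra -h2 -h3 in h1.
  by rewrite -(eqn_add2r a) h1; apply/eqP; lia.
have [R1 [R2 [R3 [eW eV fR]]]] := basis W V erefl erefl erefl.
have [||| R1' [R2' [R3' [eW' eV' fR']]]] := basis W' V'; rewrite /a ?rI //; try exact: rD.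
set R := col_mx _ R3 in fR; set R' := col_mx _ R3' in fR'.
(* The matrix [pinvmx R *m R'] carries the first basis to the second but may be singular;
   [complete_unitmx] gives an invertible matrix that agrees with it on R. *)
have RE : R *m (pinvmx R *m R') = R' by rewrite mulmxA mulmxVp // mul1mx.
have [|k uk] := @complete_unitmx _ _ _ R (pinvmx R *m R').
  by rewrite RE; move: fR fR'; rewrite /row_free => /eqP-> /eqP->.
rewrite RE !mul_col_mx => /eq_col_mx[/eq_col_mx[e1 e2] e3].
exists k; split=> //.
  rewrite /gact -gW'; apply/eq_genmx; apply: eqmx_trans (eqmxMr k (eqmx_sym eW)) _.
  by apply: eqmx_trans (addsmxMr _ _ _) _; rewrite -e1 -e2.
rewrite /gact -gV'; apply/eq_genmx; apply: eqmx_trans (eqmxMr k (eqmx_sym eV)) _.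
by apply: eqmx_trans (addsmxMr _ _ _) _; rewrite -e1 -e3.
Qed.

Lemma exists_grass Y d : (d <= \rank Y)%N -> exists A : 'M[F]_n, A \in grass Y d.
Proof.
move=> le_d; apply/set0Pn; rewrite -card_gt0 -(ltr0n algC) lt0r ler0n andbT.
by rewrite card_grass // qbinom_neq0.
Qed.

(** Take the sum of an [a]-space of W and a [(d-a)]-space of a complement of W. *)
Lemma exists_grass_meet W d a : (a <= d)%N -> (a <= \rank W)%N -> (d - a <= n - \rank W)%N ->
  exists2 U : 'M[F]_n, U \in grass 1%:M d & \rank (W :&: U) = a.
Proof.
move=> le_ad le_aW le_W; have [A /grassP[_ AW rA]] := exists_grass le_aW.
have [|B /grassP[_ BW rB]] := @exists_grass (W^C)%MS (d - a); first by rewrite mxrank_compl.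
have WB0 : (W :&: B)%MS = 0.
  by apply/eqP; rewrite -submx0 -(capmx_compl W) capmxS.
have AB0 : (A :&: B)%MS = 0 by apply/eqP; rewrite -submx0 -WB0 capmxS.
have r1 := mxrank_sum_cap A B; rewrite AB0 mxrank0 rA rB addn0 subnKC // in r1.
have r2 := mxrank_sum_cap W B; rewrite WB0 mxrank0 rB addn0 in r2.
exists <<(A + B)%MS>>%MS; first by rewrite grass_genmx submx1 r1 eqxx.
have := mxrank_sum_cap W (A + B)%MS; rewrite r1.
have -> : \rank (W + (A + B)) = \rank (W + B).
  apply: eqmx_rank; rewrite !addsmx_sub !addsmxSl !addsmxSr (submx_trans AW) ?addsmxSl //=.
  by rewrite (submx_trans (addsmxSr A B)) ?addsmxSr.
have -> : \rank (W :&: <<(A + B)%MS>>) = \rank (W :&: (A + B)).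
  by apply: eqmx_rank; rewrite !capmxS ?genmxE.
rewrite r2; lia.
Qed.

Lemma rank_gactI g U V : g \in unitmx ->
  \rank (gact U g :&: gact V g) = \rank (U :&: V).
Proof.
move=> ug; have := mxrank_sum_cap (gact U g) (gact V g); rewrite !rank_gact //.
have -> : \rank (gact U g + gact V g) = \rank (U + V).
  rewrite -(rank_gact (U + V)%MS ug); apply: eqmx_rank.
  by rewrite addsmx_sub !gactS ?addsmxSl ?addsmxSr //= genmxE addsmxMr addsmxS ?genmxE.
by rewrite -(mxrank_sum_cap U V); apply: addnI.
Qed.

Definition stabilizer W : {set 'M[F]_n} := [set g in GLset F n | gact W g == W].

(** Burnside's count: by [pair_transitive] the orbits of the stabilizer on [j]-spaces are the level
    sets of the dimension of the meet with W, and the bounds on [j] make all values 0, ..., j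
    occur. *)
Lemma sum_grass_char_stab m j W : W \in grass 1%:M m -> (j <= m)%N -> (j <= n - m)%N ->
  \sum_(g in stabilizer W) grass_char j g = j.+1%:R * #|stabilizer W|%:R.
Proof.
move=> /grassP[gW _ rW] le_jm le_jn.
transitivity (\sum_(U in grass 1%:M j) \sum_(g in stabilizer W | gact U g == U) 1 : algC).
  rewrite (exchange_big_dep (mem (stabilizer W))) /=; last by move=> ? ? _ /andP[].
  apply: eq_bigr => g sg; rewrite sum_const_natl mulr1; congr (_%:R).
  by apply: eq_card => U; rewrite [LHS]inE [RHS]inE sg.
rewrite (partition_big (fun U => inord (\rank (W :&: U)) : 'I_j.+1) predT) //=.
transitivity (\sum_(a < j.+1) #|stabilizer W|%:R : algC); last first.
  by rewrite sumr_const card_ord mulr_natl.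
apply: eq_bigr => a _; have le_aj : (a <= j)%N by rewrite -ltnS.
have [U0 gU0 rU0] : exists2 U : 'M_n, U \in grass 1%:M j & \rank (W :&: U) = a.
  apply: exists_grass_meet; rewrite ?rW ?(leq_trans le_aj) //.
  exact: leq_trans (leq_subr _ _) le_jn.
have [gU0' _ rU0'] := grassP _ _ _ gU0.
have meet_a U : U \in grass 1%:M j ->
    ((inord (\rank (W :&: U)) : 'I_j.+1) == a) = (\rank (W :&: U) == a).
  case/grassP=> _ _ rU; rewrite -val_eqE /= inordK // ltnS -rU.
  by rewrite mxrankS ?capmxSr.
(* In the stabilizer of W, the elements fixing U are as many as those carrying the representative
   [U0] to U. Summed over the orbit, the latter count each element once. *)
transitivity (\sum_(U : 'M[F]_n | (U \in grass 1%:M j) && (\rank (W :&: U) == a))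
     \sum_(g in stabilizer W | gact U0 g == U) 1 : algC).
  apply: eq_big => [U|U /andP[gU]]; first by case gU: (U \in _); rewrite //= meet_a.
  rewrite meet_a // => /eqP rWU; have [gU' _ rU] := grassP _ _ _ gU.
  have [|||k [uk Wk U0k]] := pair_transitive gW gU0' gW gU'; rewrite ?rU0' ?rU0 //.
  rewrite [RHS](reindex_inj (can_inj (mulKmx uk))) /=; apply: eq_bigl => g.
  by rewrite !inE unitmx_mul uk -!gactM Wk U0k.
rewrite (exchange_big_dep (mem (stabilizer W))) /=; last by move=> ? ? _ /andP[].
transitivity (\sum_(g in stabilizer W) 1 : algC); last first.
  by rewrite sum_const_natl mulr1; congr (_%:R); apply: eq_card => g; rewrite inE.
apply: eq_bigr => g sg; have /andP[ug /eqP Wg] : (g \in unitmx) && (gact W g == W).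
  by move: sg; rewrite !inE.
rewrite (big_pred1 (gact U0 g)) // => U; rewrite sg /= [RHS]eq_sym.
case: (eqVneq (gact U0 g) U) => [<-|]; rewrite ?andbF // gact_grass // rU0' eqxx /= andbT.
by rewrite -rU0 -{1}Wg rank_gactI // eqxx.
Qed.

Lemma char_kernel_diag m x W : W \in grass 1%:M m -> (x <= m)%N -> (x <= n - m)%N ->
  char_kernel x W W = #|stabilizer W|%:R.
Proof.
move=> gW le_xm le_xn; transitivity (\sum_(g in stabilizer W) spec_char x g).
  by apply: eq_bigl => g; rewrite [RHS]inE.
rewrite sumrB (sum_grass_char_stab gW) //; case: x le_xm le_xn => [|x] le_xm le_xn.
  by rewrite big1 // subr0 mul1r.
by rewrite (sum_grass_char_stab gW) 1?ltnW // -mulrBl -natrB // subSnn mul1r.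
Qed.

Lemma char_kernel_rank m x W V V' :
    W \in grass 1%:M m -> V \in grass 1%:M m -> V' \in grass 1%:M m ->
  \rank (W :&: V) = \rank (W :&: V') -> char_kernel x W V = char_kernel x W V'.
Proof.
move=> /grassP[gW _ rW] /grassP[gV _ rV] /grassP[gV' _ rV'] rI.
have [|||k [uk Wk <-]] := pair_transitive gW gV gW gV'; rewrite ?rV //.
by rewrite char_kernel_conj.
Qed.

Lemma card_grass1 d : (d <= n)%N -> #|grass (1%:M : 'M[F]_n) d|%:R = qbinom q n d.
Proof. by have := @card_grass F n 1%:M d; rewrite mxrank1. Qed.

Lemma card_GL_stab m W : (m <= n)%N -> W \in grass 1%:M m ->
  #|GLset F n|%:R = qbinom q n m * #|stabilizer W|%:R.
Proof.
move=> le_m gW; have [gW' _ rW] := grassP _ _ _ gW.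
transitivity (\sum_(V in grass 1%:M m) \sum_(g in GLset F n | gact W g == V) 1 : algC).
  rewrite -sum1_card natr_sum (partition_big (gact W) (mem (grass 1%:M m))) //= => g.
  by rewrite inE => ug; rewrite gact_grass ?rW.
rewrite -card_grass1 // mulr_natl -sumr_const; apply: eq_bigr => V gV.
have [gV' _ rV] := grassP _ _ _ gV.
have rI A : \rank (A :&: A) = \rank A.
  by apply: eqmx_rank; rewrite capmxSl sub_capmx !submx_refl.
have [|||k [uk Wk _]] := pair_transitive gW' gW' gV' gV'; rewrite ?rI ?rV //.
rewrite (reindex_inj (can_inj (mulmxK uk))) /= sum_const_natl mulr1; congr (_%:R).
apply: eq_card => g; rewrite !inE unitmx_mul uk andbT; congr (_ && _).
rewrite -gactM -Wk; apply/eqP/eqP => [/gact_inj -> //|->//]; rewrite ?genmx_gact //.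
Qed.

End Characters.

(** * Evaluation of the kernel and averages over a Grassmannian *)

Section Spherical.
Variables (F : finFieldType) (n : nat).
Local Notation q := (#|F|%:R : algC).
Implicit Types (A B H I U V W Y Z g k : 'M[F]_n) (d m x : nat).
Let q_gt1 := cardF_gt1 F.

Lemma rank_capmx_id A : \rank (A :&: A) = \rank A.
Proof. by apply: eqmx_rank; rewrite capmxSl sub_capmx !submx_refl. Qed.

Lemma char_kernelE m x W V : (m <= n - m)%N -> (x <= m)%N ->
    W \in grass 1%:M m -> V \in grass 1%:M m ->
  char_kernel x W V = #|stabilizer W|%:R * hahn q n m x (m - \rank (W :&: V)).
Proof.
move=> le_mn le_xm gW gV; have [_ _ rW] := grassP _ _ _ gW.
have le_m : (m <= n)%N by rewrite (leq_trans le_mn) ?leq_subr.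
have le_x : (x <= n)%N by rewrite (leq_trans le_xm).
(* By [char_kernel_rank] the choice of V is immaterial. The default 0 concerns only values of [i]
   realized by no [m]-space; every i <= m is realized because m <= n - m. *)
pose h i := if [pick V in grass 1%:M m | (m - \rank (W :&: V) == i)%N] is Some V
  then char_kernel x W V else 0.
have r_le V' : (\rank (W :&: V') <= m)%N by rewrite -rW mxrankS ?capmxSl.
have hE V' : V' \in grass 1%:M m -> char_kernel x W V' = h (m - \rank (W :&: V'))%N.
  move=> gV'; rewrite /h; case: pickP => [V2 /andP[gV2 /eqP e]|/(_ V')]; last by rewrite gV' eqxx.
  by apply: (char_kernel_rank _ gW) => //; have := r_le V'; have := r_le V2; lia.
rewrite hE //; apply: (walk_unique q_gt1 le_mn (c := - walk_eig q m (n - m) x)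
  (g := fun i => #|stabilizer W|%:R * hahn q n m x i)); rewrite ?leq_subr //.
- move=> i lt_im; have [V' gV' rV'] :
      exists2 V', V' \in grass 1%:M m & \rank (W :&: V') = (m - i)%N.
    by apply: exists_grass_meet; rewrite ?rW ?leq_subr //; lia.
  have iE : (m - \rank (W :&: V') = i)%N by rewrite rV' subKn // ltnW.
  have := grass_walk h gW gV'; rewrite iE mxrank1 => e.
  have := char_kernel_eigen le_m le_x gW gV'; rewrite hE // iE.
  under eq_bigr => V2 gV2 do rewrite (hE V2 gV2).
  (* The constant [m][n-m+1] appears in both formulas and cancels. *)
  by rewrite e walk_eigE // subnKC // => /(canRL (addrK _)) ->; ring.
- move=> i lt_im; rewrite /walk -!mulrBr !(mulrCA _ #|stabilizer W|%:R) -mulrDr.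
  by have := hahn_walk q_gt1 i le_mn le_m le_xm; rewrite /walk => ->; rewrite mulrCA.
have := hE W gW; rewrite rank_capmx_id rW subnn => <-.
by rewrite (char_kernel_diag gW) ?hahn0 ?mulr1 // (leq_trans le_xm).
Qed.

(** The common-hyperplane matrix is symmetric with constant row sums, so applying it multiplies the
    total of a function by that constant, which the diagonal term of [grass_walk] subtracts. *)
Lemma sum_walk0 m Y U (h : nat -> algC) : U \in grass Y m ->
  \sum_(V in grass Y m) walk q m (\rank Y - m) h (m - \rank (U :&: V)) = 0.
Proof.
move=> gU.
have rowsum V : V \in grass Y m -> \sum_(W in grass Y m) #|hplanes W :&: hplanes V|%:R =
    qint q m * qint q (\rank Y - m).+1 :> algC.
  move=> gV; have := grass_walk (fun=> 1) gV gV; rewrite /= /walk !subrr !mulr0 !add0r mulr1 => <-.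
  by apply: eq_bigr => W _; rewrite mulr1 setIC.
have e : \sum_(V in grass Y m) \sum_(W in grass Y m)
     #|hplanes V :&: hplanes W|%:R * h (m - \rank (U :&: W))%N =
   \sum_(V in grass Y m) qint q m * qint q (\rank Y - m).+1 * h (m - \rank (U :&: V))%N.
  by rewrite exchange_big /=; apply: eq_bigr => W gW; rewrite -mulr_suml rowsum.
rewrite -[LHS](addrK (\sum_(V in grass Y m) qint q m * qint q (\rank Y - m).+1
  * h (m - \rank (U :&: V))%N)) -big_split /= -e -sumrB big1 // => V gV.
by rewrite (grass_walk h gU gV) subrr.
Qed.

(* The walk is stationary on the Grassmannian, so averaging walk_qpochS gives a
   first-order recursion in r for this sum. *)
Lemma sum_qpoch m Y U r : U \in grass Y m ->
  (\sum_(V in grass Y m) qpoch q (q ^- (m - \rank (U :&: V))) r)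
    * qpoch q (q ^- \rank Y) r =
  qbinom q (\rank Y) m * (qpoch q (q ^- m) r * qpoch q (q ^- (\rank Y - m)) r).
Proof.
move=> gU; have le_m : (m <= \rank Y)%N.
  by case/grassP: gU => _ UY <-; apply: mxrankS.
elim: r => [|r IHr].
  have q1 a : qpoch q a 0 = 1 by rewrite /qpoch big_ord0.
  by under eq_bigr do rewrite q1; rewrite !q1 !mulr1 sumr_const card_grass.
have := sum_walk0 (fun i => qpoch q (q ^- i) r.+1) gU.
under eq_bigr => V gV do rewrite walk_qpochS //.
rewrite big_split /= -!mulr_sumr; move: IHr.
set G := \sum_(V in _) _; set G' := \sum_(V in _) qpoch _ _ r.+1.
rewrite !qpochS /walk_eig /walk_low !qintE // => IHr e.
have qY : q ^+ \rank Y = q ^+ m * q ^+ (\rank Y - m) by rewrite -exprD subnKC.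
have := (expq_neq0 q_gt1 m, expq_neq0 q_gt1 (\rank Y - m), expq_neq0 q_gt1 r,
         q_neq0 q_gt1, onesubq_neq0 q_gt1).
have r0 : 1 - q ^+ r.+1 != 0 by rewrite subr_eq0 -(expr0 q) expq_inj.
move: e r0 IHr; rewrite !qY !exprS.
move: (qpoch _ _ _) (qpoch _ _ _) (qpoch _ _ _) (qbinom _ _ _) => P1 P2 P3 b0.
move: (q ^+ m) (q ^+ (\rank Y - m)) (q ^+ r) => a b y e r0 IHr [[[[a0 b0'] y0] q0] q1].
(* Stationarity balances the diagonal term in [G'] against the lowering term in [G]; the nonzero
   common factor [c0] is divided out. *)
have key : G' * (1 - (a * b)^-1 * y) = G * ((1 - a^-1 * y) * (1 - b^-1 * y)).
  have c0 : (1 - q * y) * a * b / (y * (1 - q) ^+ 2) != 0.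
    by rewrite !mulf_neq0 ?invr_eq0 ?mulf_neq0 ?expf_neq0.
  apply: (mulfI c0); apply/eqP; rewrite -subr_eq0 -{}e -subr_eq0; apply/eqP.
  by field; rewrite q1 q0 a0 b0' y0.
transitivity (P3 * (G' * (1 - (a * b)^-1 * y))); first by ring.
rewrite key; transitivity (G * P3 * ((1 - a^-1 * y) * (1 - b^-1 * y))); first by ring.
rewrite IHr; ring.
Qed.

End Spherical.

(** * Reduction of the projector to spherical kernels *)

Section Translation.
Variables (F : finFieldType) (n : nat).
Local Notation q := (#|F|%:R : algC).
Implicit Types (A B U V g : 'M[F]_n) (d x : nat).
Let q_gt1 := cardF_gt1 F.

Lemma spanset_sub m1 m2 (A : 'M[F]_(m1, n)) (B : 'M[F]_(m2, n)) :
  (spanset A \subset spanset B) = (A <= B)%MS.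
Proof.
apply/subsetP/idP => [sAB|sAB v]; last by rewrite !inE => /submx_trans->.
by apply/row_subP => i; have := sAB (row i A); rewrite !inE row_sub; apply.
Qed.

Lemma spanset_genmx m (A : 'M[F]_(m, n)) : spanset <<A>>%MS = spanset A.
Proof. by apply/setP => v; rewrite !inE genmxE. Qed.

Lemma spanset_eq A B : (spanset A == spanset B) = (<<A>>%MS == <<B>>%MS).
Proof. by rewrite eqEsubset !spanset_sub; apply/genmxP/eqP. Qed.

Lemma img_spanset m g (A : 'M[F]_(m, n)) : img g (spanset A) = spanset (A *m g).
Proof.
apply/setP => v; rewrite inE; apply/imsetP/submxP => [[u]|[D ->]].
  by rewrite inE => /submxP[D ->] ->; exists D; rewrite mulmxA.
by exists (D *m A); rewrite ?mulmxA // inE submxMl.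
Qed.

Lemma subspaces_of_dimE d : subspaces_of_dim F n d = @spanset F n n @: grass 1%:M d.
Proof.
apply/setP => S; apply/imsetP/imsetP => -[A rA ->].
  exists <<A>>%MS; last by rewrite spanset_genmx.
  by rewrite grass_genmx submx1; move: rA; rewrite inE.
by exists A => //; case/grassP: rA => _ _; rewrite inE => ->.
Qed.

Lemma perm_charE d g : perm_char d g = grass_char d g.
Proof.
congr (_%:R); rewrite -[RHS](card_in_imset (f := @spanset F n n)); last first.
  move=> A B; rewrite !inE => /andP[/and3P[/eqP gA _ _] _] /andP[/and3P[/eqP gB _ _] _] /eqP.
  by rewrite spanset_eq gA gB => /eqP.
have imgE A : <<A>>%MS = A -> (img g (spanset A) == spanset A) = (gact A g == A).
  by move=> gA; rewrite img_spanset spanset_eq gA.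
apply: eq_card => S; rewrite [LHS]inE subspaces_of_dimE; apply/andP/imsetP.
  case=> /imsetP[A gA ->] e; exists A => //; rewrite inE gA.
  by case/grassP: gA => gA _ _; rewrite -imgE.
case=> A sA ->; have /andP[gA eA] : (A \in grass 1%:M d) && (gact A g == A).
  by move: sA; rewrite inE.
by rewrite imset_f // imgE //; case/grassP: gA.
Qed.

Lemma chiE x g : chi x g = spec_char x g.
Proof. by rewrite /chi /spec_char; case: x => [|x]; rewrite !perm_charE. Qed.

Lemma dimVE x : (x <= n)%N ->
  dimV F n x = qbinom q n x - (if x is x'.+1 then qbinom q n x' else 0).
Proof.
have p1 d : (d <= n)%N -> grass_char d (1%:M : 'M[F]_n) = qbinom q n d.
  move=> le_d; rewrite -card_grass1 //; congr (_%:R); apply: eq_card => A.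
  rewrite inE; case gA: (A \in _) => //=; apply/eqP/gact1.
  by case/grassP: gA.
move=> le_x; rewrite /dimV chiE /spec_char p1 //.
by case: x le_x => // x le_x; rewrite p1 // ltnW.
Qed.

Lemma line_spanset (L : line_type F n) : exists2 B, B \in grass 1%:M 1 & val L = spanset B.
Proof. by case: L => S /=; rewrite subspaces_of_dimE => /imsetP. Qed.

Definition mkline d (A : 'M[F]_(d, n)) (rA : \rank A = 1) : line_type F n.
Proof.
exists (spanset A); rewrite -spanset_genmx subspaces_of_dimE imset_f //.
by rewrite grass_genmx submx1 rA.
Defined.

(** An invertible [g] maps lines to lines, so the default value of [insubd] is never taken. *)
Lemma act_lineE g (L : line_type F n) : g \in unitmx -> val (act_line g L) = img g (val L).
Proof.
move=> ug; have [B gB eB] := line_spanset L; have [_ _ rB] := grassP _ _ _ gB.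
have e : img g (val L) = spanset (gact B g) by rewrite spanset_genmx -img_spanset eB.
have sI : img g (val L) \in subspaces_of_dim F n 1.
  by rewrite e subspaces_of_dimE imset_f // gact_grass // rB.
by rewrite /act_line insubdK.
Qed.

Definition lines (W : {set 'rV[F]_n}) : {set line_type F n} :=
  [set L : line_type F n | val L \subset W].

Lemma act_conf_lines g A : g \in unitmx ->
  act_conf g (lines (spanset A)) = lines (spanset (gact A g)).
Proof.
move=> ug; have spE : spanset (gact A g) = img g (spanset A).
  by rewrite img_spanset spanset_genmx.
apply/setP => L; apply/imsetP/idP => [[L' sL' ->]|].
  rewrite inE act_lineE // spE imsetS //; by move: sL'; rewrite inE.
rewrite inE => sL; have [B gB eB] := line_spanset L; have [gB' _ rB] := grassP _ _ _ gB.
have rB' : \rank (gact B (invmx g)) = 1 by rewrite rank_gact ?unitmx_inv.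
exists (mkline rB').
  rewrite inE /= spanset_sub; move: sL; rewrite eB spanset_sub genmxE => /(gactS (invmx g)).
  by move/submx_trans; apply; rewrite genmxE mulmxK.
by apply: val_inj; rewrite act_lineE //= img_spanset -spanset_genmx -/(gact _ _) gactVK.
Qed.

(** A space is spanned by the lines it contains, so distinct subspaces give distinct basis states of
    the tensor space. *)
Lemma lines_eq A B : (lines (spanset A) == lines (spanset B)) = (<<A>>%MS == <<B>>%MS).
Proof.
rewrite -spanset_eq; apply/eqP/eqP => [eAB|->//]; apply/eqP; rewrite eqEsubset !spanset_sub.
have sub A' B' : lines (spanset A') = lines (spanset B') -> (A' <= B')%MS.
  move=> e; apply/row_subP => i; have [->|nz] := eqVneq (row i A') 0; first exact: sub0mx.
  have r1 : \rank (row i A') = 1%N by rewrite rank_rV nz.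
  have : mkline r1 \in lines (spanset A') by rewrite inE /= spanset_sub row_sub.
  by rewrite e inE /= spanset_sub.
by rewrite !sub.
Qed.

Lemma dotT_phiT (X : {set {set 'rV[F]_n}}) (c : algC) g :
  let f := [ffun S => c * \sum_(W in X) eW W S] : {ffun {set line_type F n} -> algC} in
  dotT f (phiT g f) =
  c^* * c * \sum_(W in X) \sum_(W' in X) (act_conf g (lines W) == lines W')%:R.
Proof.
move=> f.
have fE S : f S = c * \sum_(W in X) (S == lines W)%:R.
  by rewrite ffunE; congr (_ * _); apply: eq_bigr => W _; rewrite ffunE.
have phiE S : phiT g f S = c * \sum_(W in X) (act_conf g (lines W) == S)%:R.
  rewrite ffunE; under eq_bigr do rewrite fE; rewrite -mulr_sumr exchange_big /=.
  congr (_ * _); apply: eq_bigr => W _; rewrite big_mkcond (bigD1 (lines W)) //= eqxx.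
  rewrite big1 ?addr0 => [|S' /negPf ne]; first by case: eqP.
  by rewrite ne; case: ifP.
rewrite /dotT; under eq_bigr => S _.
  rewrite fE phiE rmorphM mulrACA /= (raddf_sum (Num.conj_op : algC -> algC)) /=.
  under eq_bigr do rewrite conjC_nat.
  over.
rewrite -mulr_sumr; congr (_ * _).
under eq_bigr do rewrite mulr_suml; rewrite exchange_big /= [RHS]exchange_big /=.
apply: eq_bigr => W _; rewrite (bigD1 (lines W)) //= eqxx mul1r.
rewrite [X in _ + X]big1 ?addr0 // => S /negPf->.
by rewrite mul0r.
Qed.

Definition xi_grass A (Y : 'M[F]_n) m d : {set 'M[F]_n} :=
  [set W in grass 1%:M m | (A <= W)%MS && (\rank (W :&: Y) == d)].

Lemma pGLE (Bs : 'M[F]_n) m k l x :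
  let P := xi_grass (pid_mx l *m Bs) (copid_mx k *m Bs) m (m - l) in
  (m - l <= n - k)%N ->
  pGL Bs m k l x = dimV F n x / #|GLset F n|%:R / qbinom q (n - k) (m - l)
    * \sum_(W in P) \sum_(V in P) char_kernel x W V.
Proof.
move=> P le_ml.
have XiE : Xi_set Bs m k l = @spanset F n n @: P.
  apply/setP => S; apply/imsetP/imsetP => -[A sA ->].
    move: sA; rewrite inE => /and3P[lA rA rI]; exists <<A>>%MS; last by rewrite spanset_genmx.
    rewrite inE grass_genmx submx1 rA genmxE lA /=.
    by rewrite (eqmx_rank (_ : (_ == A :&: copid_mx k *m Bs)%MS)) // !capmxS ?genmxE.
  move: sA; rewrite inE => /andP[/grassP[_ _ rA] /andP[lA rI]]; exists A => //.
  by rewrite inE lA rA eqxx.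
have P_inj : {in P &, injective (@spanset F n n)}.
  move=> A B; rewrite !inE => /andP[/and3P[/eqP gA _ _] _] /andP[/and3P[/eqP gB _ _] _] /eqP.
  by rewrite spanset_eq gA gB => /eqP.
(* The q-binomial counts subspaces, so its square root is real and conjugation does not affect the
   normalization. *)
have b_ge0 : 0 <= qbinom q (n - k) (m - l).
  have := @card_grass F n (pid_mx (n - k)) (m - l); rewrite rank_pid_mx ?leq_subr //.
  by move=> <- //; rewrite ler0n.
have ccE : ((sqrtC (qbinom q (n - k) (m - l)))^-1)^* * (sqrtC (qbinom q (n - k) (m - l)))^-1
    = (qbinom q (n - k) (m - l))^-1.
  rewrite fmorphV /= conj_Creal ?ger0_real ?sqrtC_ge0 //.
  by rewrite -invfM -expr2 sqrtCK.
have -> : pGL Bs m k l x = dimV F n x / #|GLset F n|%:R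
    * \sum_(g in GLset F n) spec_char x g * dotT (Xi Bs m k l) (phiT g (Xi Bs m k l)).
  rewrite /pGL {1}/dotT; under eq_bigr => S _.
    rewrite [in X in _ * X]ffunE mulrCA mulr_sumr.
    over.
  rewrite -mulr_sumr exchange_big /=; congr (_ * _); apply: eq_bigr => g _.
  by rewrite /dotT mulr_sumr; apply: eq_bigr => S _; rewrite chiE mulrCA.
rewrite -[RHS]mulrA; congr (_ * _).
transitivity (\sum_(g in GLset F n) (qbinom q (n - k) (m - l))^-1 *
    \sum_(W in P) \sum_(V in P) (gact W g == V)%:R * spec_char x g).
  apply: eq_bigr => g; rewrite inE => ug; rewrite dotT_phiT ccE mulrCA; congr (_ * _).
  rewrite XiE big_imset //= mulr_sumr; apply: eq_bigr => W WP.
  rewrite big_imset //= mulr_sumr; apply: eq_bigr => V VP; rewrite mulrC; congr (_%:R * _).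
  rewrite act_conf_lines // lines_eq genmx_gact; congr (nat_of_bool (_ == _)).
  by move: VP; rewrite inE => /andP[/grassP[]].
rewrite -mulr_sumr; congr (_ * _); rewrite exchange_big; apply: eq_bigr => W _.
rewrite exchange_big; apply: eq_bigr => V _; rewrite /char_kernel big_mkcondr /=.
by apply: eq_bigr => g _; case: eqP => _; rewrite ?mul1r ?mul0r.
Qed.

End Translation.

(** * The subspaces in [Xi] as sums of V_l and subspaces of V_k^c *)

Section XiSubspaces.
Variables (F : finFieldType) (n : nat).
Local Notation q := (#|F|%:R : algC).
Implicit Types (A B U V W L Y g : 'M[F]_n) (d x : nat).
Let q_gt1 := cardF_gt1 F.

(** Adding L raises the dimension of every subspace of Y by that of L. Hence the codimension of the
    meet, the argument of the q-Hahn polynomial, can be computed inside Y. *)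
Lemma xi_grass_meet L Y m d : (L :&: Y)%MS = 0 -> (\rank L + d)%N = m ->
  forall U V, U \in grass Y d -> V \in grass Y d ->
  \rank (<<(L + U)%MS>> :&: <<(L + V)%MS>>) = (\rank L + \rank (U :&: V))%N.
Proof.
move=> LY0 rm U V /grassP[_ UY rU] /grassP[_ VY rV].
have disj Z : (Z <= Y)%MS -> \rank (L + Z) = (\rank L + \rank Z)%N.
  by move=> ZY; apply/mxrank_disjoint_sum/eqP; rewrite -submx0 -LY0 capmxS.
have -> : \rank (<<(L + U)%MS>> :&: <<(L + V)%MS>>) = \rank ((L + U) :&: (L + V)).
  by apply: eqmx_rank; rewrite !capmxS ?genmxE.
have := mxrank_sum_cap (L + U)%MS (L + V)%MS.
have -> : \rank ((L + U) + (L + V)) = \rank (L + (U + V)).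
  have sU : (L + U <= (L + U) + (L + V))%MS by apply: addsmxSl.
  have sV : (L + V <= (L + U) + (L + V))%MS by apply: addsmxSr.
  apply: eqmx_rank; rewrite !addsmx_sub (submx_trans (addsmxSl L U) sU).
  rewrite (submx_trans (addsmxSr L U) sU) (submx_trans (addsmxSr L V) sV) !addsmxSl !andbT.
  by rewrite !(submx_trans _ (addsmxSr L (U + V)%MS)) ?addsmxSl ?addsmxSr.
have UVY : (U + V <= Y)%MS by rewrite addsmx_sub UY.
have := mxrank_sum_cap U V; rewrite (disj _ _ UVY) (disj _ _ UY) (disj _ _ VY) rU rV.
lia.
Qed.

(** The inverse map is W to W meet Y; dimensions give W = L + (W meet Y). *)
Lemma xi_grassE L Y m d : (L :&: Y)%MS = 0 -> (\rank L + d)%N = m ->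
  xi_grass L Y m d = (fun U => <<(L + U)%MS>>%MS) @: grass Y d.
Proof.
move=> LY0 rm.
have disj Z : (Z <= Y)%MS -> \rank (L + Z) = (\rank L + \rank Z)%N.
  by move=> ZY; apply/mxrank_disjoint_sum/eqP; rewrite -submx0 -LY0 capmxS.
apply/setP => W; apply/idP/imsetP => [|[U /grassP[gU UY rU] ->]].
  rewrite inE => /and3P[/grassP[gW _ rW] LW /eqP rI].
  exists <<(W :&: Y)%MS>>%MS; first by rewrite grass_genmx capmxSr rI eqxx.
  apply/esym/genmx_sub_eq; rewrite ?genmx_id // genmxE.
    by rewrite addsmx_sub LW genmxE capmxSl.
  by rewrite disj ?genmxE ?capmxSr // rI rm rW.
rewrite inE grass_genmx submx1 genmxE addsmxSl disj // rU rm eqxx /=.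
have -> : \rank (<<(L + U)%MS>> :&: Y) = \rank ((L + U) :&: Y).
  by apply: eqmx_rank; rewrite !capmxS ?genmxE.
have := mxrank_sum_cap (L + U)%MS Y; rewrite disj // rU.
have -> : \rank ((L + U) + Y) = \rank (L + Y).
  by apply: eqmx_rank; rewrite !addsmx_sub !addsmxSl addsmxSr (submx_trans UY) ?addsmxSr //=
    (submx_trans (addsmxSl L U)) ?addsmxSl.
rewrite disj // => e; apply/eqP; lia.
Qed.

Lemma xi_grass_inj L Y d : (L :&: Y)%MS = 0 ->
  {in grass Y d &, injective (fun U => <<(L + U)%MS>>%MS : 'M[F]_n)}.
Proof.
move=> LY0 U V gU gV e; have := xi_grass_meet LY0 erefl gU gV; rewrite e.
have -> : \rank (<<(L + V)%MS>> :&: <<(L + V)%MS>>) = (\rank L + d)%N.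
  rewrite (xi_grass_meet LY0 erefl gV gV) rank_capmx_id.
  by case/grassP: gV => _ _ ->.
move/addnI => rI; have [_ _ rU] := grassP _ _ _ gU; apply: (grass_sub_eq gU gV).
have sUV : (U <= U :&: V)%MS by rewrite -(geq_leqif (mxrank_leqif_sup (capmxSl U V))) rU -rI.
exact: submx_trans sUV (capmxSr _ _).
Qed.

(** In the coordinates of [Bs], the projection [pid_mx k] is the identity on the first space and
    zero on the second. *)
Lemma pid_copid_disjoint (Bs : 'M[F]_n) l k : Bs \in unitmx -> (l <= k)%N -> (k <= n)%N ->
  ((pid_mx l : 'M[F]_n) *m Bs :&: (copid_mx k : 'M[F]_n) *m Bs)%MS = 0.
Proof.
move=> uB le_lk le_kn; set X := (_ :&: _)%MS.
have [D1 e1] := submxP (capmxSl _ _ : (X <= pid_mx l *m Bs)%MS).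
have [D2 e2] := submxP (capmxSr _ _ : (X <= copid_mx k *m Bs)%MS).
have h1 : X *m invmx Bs *m pid_mx k *m Bs = X.
  rewrite {1}e1 -!mulmxA (mulmxA Bs) mulmxV // mul1mx (mulmxA (pid_mx l)) mul_pid_mx.
  by rewrite (minn_idPl le_lk) pid_mx_minv -e1.
have h2 : X *m invmx Bs *m pid_mx k *m Bs = 0.
  rewrite {1}e2 -!mulmxA (mulmxA Bs) mulmxV // mul1mx (mulmxA (copid_mx k)) mul_copid_mx_pid //.
  by rewrite mul0mx mulmx0.
by rewrite -h1 h2.
Qed.

End XiSubspaces.

Theorem theoremC4 (F : finFieldType) (n m k l x : nat) (Bs : 'M[F]_n) :
  Bs \in unitmx ->
  (m <= n)%N -> (k <= n)%N ->
  (m + k <= n + l)%N -> (l <= minn m k)%N ->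
  (m <= n - m)%N -> (x <= m)%N ->
  let q : algC := #|F|%:R in
  let M := (m - l)%N in
  let N := (n + l - (m + k))%N in
  pGL Bs m k l x =
    qbinom q (n - k) (m - l) * (qbinom q n x / qbinom q n m)
    * q ^+ x * (qint q (n - 2 * x + 1)%N / qint q (n - x + 1)%N)
    * phi43 q (q ^- x) (q ^+ x / q ^+ n.+1) (q ^- M) (q ^- N)
              (q ^- m) (q ^+ m / q ^+ n) (q ^- (M + N)) q x.
Proof.
move=> uB le_mn le_kn le_mk; rewrite leq_min => /andP[le_lm le_lk] le_m le_xm q M N.
have q_gt1 : 1 < q := cardF_gt1 F.
have MN : (M + N = n - k)%N by rewrite /M /N; lia.
have le_M : (M <= n - k)%N by rewrite -MN leq_addr.
set L := (pid_mx l : 'M[F]_n) *m Bs; set Y := (copid_mx k : 'M[F]_n) *m Bs.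
have LY0 : (L :&: Y)%MS = 0 := pid_copid_disjoint uB le_lk le_kn.
have fB : row_free Bs by rewrite row_free_unit.
have rL : \rank L = l by rewrite mxrankMfree // rank_pid_mx // (leq_trans le_lm).
have rY : \rank Y = (n - k)%N by rewrite mxrankMfree // rank_copid_mx.
have rm : (\rank L + M)%N = m by rewrite rL /M subnKC.
have B0 : qbinom q (n - k) M != 0 by apply: qbinom_neq0.
have b0 : qbinom q n m != 0 by apply: qbinom_neq0.
rewrite pGLE // -/L -/Y -/M (xi_grassE LY0 rm).
rewrite (big_imset _ (@xi_grass_inj F n L Y M LY0)) /=.
(* By orbit-stabilizer this is the order of the stabilizer of any [m]-space. *)
set c := #|GLset F n|%:R / qbinom q n m.
have GL0 : #|GLset F n|%:R != 0 :> algC.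
  by rewrite pnatr_eq0 -lt0n; apply/card_gt0P; exists 1%:M; rewrite inE unitmx1.
have kerE U V : U \in grass Y M -> V \in grass Y M ->
    char_kernel x <<(L + U)%MS>>%MS <<(L + V)%MS>>%MS = c * hahn q n m x (M - \rank (U :&: V)).
  move=> gU gV; have inG Z : Z \in grass Y M -> <<(L + Z)%MS>>%MS \in grass 1%:M m.
    move=> gZ; have : <<(L + Z)%MS>>%MS \in xi_grass L Y m M by rewrite (xi_grassE LY0 rm) imset_f.
    by rewrite inE => /andP[].
  rewrite (char_kernelE le_m le_xm (inG _ gU) (inG _ gV)); congr (_ * hahn _ _ _ _ _).
    by rewrite /c (card_GL_stab le_mn (inG _ gU)) mulrAC mulfV // mul1r.
  by rewrite (xi_grass_meet LY0 rm gU gV) -{1}rm subnDl.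
pose phi := phi43 q (q ^- x) (q ^+ x / q ^+ n.+1) (q ^- M) (q ^- N)
              (q ^- m) (q ^+ m / q ^+ n) (q ^- (M + N)) q x.
have inner U : U \in grass Y M ->
    \sum_(V in grass Y M) hahn q n m x (M - \rank (U :&: V)) = qbinom q (n - k) M * phi.
  move=> gU; rewrite /hahn exchange_big /= /phi /phi43 mulr_sumr; apply: eq_bigr => r _.
  rewrite -mulr_sumr; have := sum_qpoch r gU; rewrite rY -MN addKn MN => e.
  (* For r > n - k the denominator (q^-(n-k); q)_r is zero and [sum_qpoch] cannot be divided by it;
     but then (q^-M; q)_r and every summand vanish too. *)
  have [lt_r|le_r] := ltnP (n - k) r.
    have z0 j : (j <= n - k)%N -> qpoch q (q ^- j) r = 0.
      by move=> le_j; apply/eqP; rewrite qpoch_eq0 // (leq_ltn_trans le_j).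
    rewrite big1 => [|V _]; last by rewrite z0 // (leq_trans (leq_subr _ _)).
    by rewrite (z0 M) // !(mulr0, mul0r).
  have nz : qpoch q (q ^- (n - k)) r != 0 by rewrite qpoch_eq0 // -leqNgt.
  rewrite (canRL (mulfK nz) e) /hahn_coef.
  by rewrite !invfM; ring.
(* The inner sum does not depend on U, so the outer sum gives a second factor [qbinom q (n - k) M];
   one of the two cancels the normalization of [Xi]. *)
rewrite (eq_bigr (fun=> c * (qbinom q (n - k) M * phi))) => [|U gU]; last first.
  rewrite (big_imset _ (@xi_grass_inj F n L Y M LY0)) /= -(inner U gU) mulr_sumr.
  by apply: eq_bigr => V gV; apply: kerE.
have sum_grass (z : algC) : \sum_(U in grass Y M) z = qbinom q (n - k) M * z.
  by rewrite -rY -(card_grass (Y := Y)) ?rY // mulr_natl -sumr_const.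
rewrite sum_grass -/phi.
have -> : dimV F n x = qbinom q n x * (q ^+ x * (qint q (n - 2 * x + 1) / qint q (n - x + 1))).
  have le_xn : (x <= n)%N by rewrite (leq_trans le_xm).
  rewrite dimVE //; case: x le_xm le_xn {kerE inner phi} => [|y] le_xm le_xn.
    by rewrite muln0 !subn0 expr0 divff ?qint_neq0 ?addn1 // !mulr1 subr0.
  by rewrite [q ^+ _ * (_ / _)]mulrA -qbinom_diff //; lia.
rewrite /c; move: GL0 B0 b0; move: (qint _ _ / qint _ _) => z.
move: (qbinom _ (n - k) _) (qbinom _ n m) (qbinom _ n x) (#|_|%:R) => b1 b2 b3 b4 h1 h2 h3.
by field; rewrite h1 h2 h3.
Qed.
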